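(* Let $n\ge 1$ and real parameters $\alpha,\beta,\gamma$ be such that the integrals below converge. Then \[ \left\langle x_1^{-2}\right\rangle_{n,\alpha,\beta,\gamma} = \frac{\alpha+\beta+(n-1)\gamma-1}{(\alpha-1)(\alpha-2)}\cdot\left(\alpha+\beta - 2 + \frac{\gamma(n-1)(\alpha+\beta+n\gamma-1)}{\alpha+\gamma -1}\right). \]
   Context: Define the weight on $[0,1]^n$ \[w_{n,\alpha,\beta,\gamma}(x) = \prod_{i<j}|x_i-x_j|^{2\gamma}\prod_{i=1}^{n}x_i^{\alpha-1}\prod_{i=1}^{n}(1-x_i)^{\beta-1},\] and for a function $f$ define the average \[\left\langle f(x_1,\ldots,x_n)\right\rangle_{n,\alpha,\beta,\gamma} = \frac{\int_0^{1}\cdots\int_{0}^{1}f(x_1,\ldots,x_n)\,w_{n,\alpha,\beta,\gamma}(x)\,dx}{\int_0^{1}\cdots\int_{0}^{1}w_{n,\alpha,\beta,\gamma}(x)\,dx}\] (the Jacobi Ensemble average). *)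

(* Defs.v *)
From HB Require Import structures.
From mathcomp Require Import all_boot all_order all_algebra.
From mathcomp Require Import all_classical all_reals all_analysis.
Set Implicit Arguments. Unset Strict Implicit. Unset Printing Implicit Defensive.
Import Order.TTheory GRing.Theory Num.Theory.
Local Open Scope classical_set_scope.
Local Open Scope ring_scope.

Definition scons {R : realType} (t : R) (y : nat -> R) : nat -> R :=
  fun k => if k is k'.+1 then y k' else t.

(* Iterated Lebesgue integral over the cube [0,1]^k of an (extended-real)
   function of the first k coordinates x 0, ..., x (k-1):
   cube_int k F = \int_0^1 ... \int_0^1 F(x_0,...,x_{k-1}) dx_{k-1} ... dx_0.
   For nonnegative integrands this equals the integral w.r.t. the product
   Lebesgue measure on [0,1]^k (Tonelli). *)
Fixpoint cube_int {R : realType} (k : nat) (F : (nat -> R) -> \bar R) : \bar R :=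
  match k with
  | 0 => F (fun _ => 0)
  | k'.+1 => (\int[@lebesgue_measure R]_(t in `[0%R, 1%R]) cube_int k' (fun y => F (scons t y)))%E
  end.

(* The Jacobi ensemble weight w_{n,alpha,beta,gamma}(x), with x_1,...,x_n
   represented as x 0, ..., x (n-1). *)
Definition jacobi_weight {R : realType} (n : nat) (a b g : R) (x : nat -> R) : R :=
  (\prod_(i < n) \prod_(j < n | (i < j)%N) (`|x i - x j| `^ (2 * g)))
  * (\prod_(i < n) (x i `^ (a - 1)))
  * (\prod_(i < n) ((1 - x i) `^ (b - 1))).

Definition jacobi_avg {R : realType} (n : nat) (a b g : R) (f : (nat -> R) -> R) : R :=
  fine (cube_int n (fun x => (f x * jacobi_weight n a b g x)%:E))
  / fine (cube_int n (fun x => (jacobi_weight n a b g x)%:E)).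

(* Main.v *)
Require Import Defs.
From HB Require Import structures.
From mathcomp Require Import all_boot all_order all_algebra.
From mathcomp Require Import all_classical all_reals all_analysis measurable_realfun.
From mathcomp Require Import perm ring lra.
Set Implicit Arguments. Unset Strict Implicit. Unset Printing Implicit Defensive.
Import Order.TTheory GRing.Theory Num.Theory.
Import numFieldNormedType.Exports.
Local Open Scope classical_set_scope.
Local Open Scope ring_scope.

(** For c, d >= 0 and small s > 0, the map x = y - s (1 - y) (c + d / y) satisfies
      x - x' = (y - y') (1 + s (c + d / (y y'))),  1 - x = (1 - y) (1 + s (c + d / y)),
      x = y (1 - s (1 - y) (c + d / y) / y),       dx/dy = 1 + s (c + d / y^2),
    so substituting it in every variable multiplies the weight by an explicit factor
    1 + s k(y) + o(s), with error dominated by integrable poles.  As the integral does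
    not change, the integral of k against the weight vanishes.  This replaces
    integration by parts, whose individual terms need not be integrable when
    gamma <= 0.  With (c, d) = (1, 0), (0, 1), and (1, 0) for the weight divided by
    x_m, summed over m, one gets three linear equations between the integrals of the
    weight times 1, sum 1/x_i, sum 1/x_i^2 and sum_{i <> j} 1/(x_i x_j); they
    determine <x_1^-2>.  Convergence forces alpha > 2, and alpha + gamma - 1 = 0
    would force <1/x_1> = 1, which is impossible. *)

(** * Iterated integrals over the cube *)

(** To first order, the explicit factor is the divergence of w v divided by w, for the field v_i =
    -(1 - x_i)(c + d/x_i). The field vanishes at 1, so no condition on beta enters; at 0 it points
    out of the cube, and points leave through that face. Two devices control the loss. The Jacobian
    is set to 0 at points shifted below 0, which keeps the domain of integration fixed; and at such
    points s times the sum of the poles is at least 1, so the loss is dominated by the same poles as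
    the other errors. The factor coming from x_i^e can approach 0, so its exponent e must be
    positive to keep it bounded. Dividing the weight by x_m lowers one exponent to alpha - 2, and
    this is where alpha > 2 enters. Iterated integrals suit the substitution, done one variable at a
    time, and Tonelli. Dominated convergence and linearity for signed integrands need a genuine
    measure, so the iterated integral is also represented by a single probability measure on
    sequences. *)

Section prob_of_measure.
Context d (T : measurableType d) (R : realType) (m : {measure set T -> \bar R}).

Definition prob_of_measure of m setT = 1%E : set T -> \bar R := m.

Hypothesis m1 : m setT = 1%E.
HB.instance Definition _ := Measure.on (prob_of_measure m1).
HB.instance Definition _ :=
  Measure_isProbability.Build _ _ _ (prob_of_measure m1) m1.

End prob_of_measure.

Section seq_space.
Context {R : realType}.

(** Generators of the coarsest sigma-algebra that makes all coordinates measurable. Taking all of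
    [nat -> R] gives one space for every dimension; [cube_int] fills the coordinates beyond the
    dimension with 0. *)
Definition cylinders : set (set (nat -> R)) :=
  [set A | exists i, exists2 B : set (measurableTypeR R),
     measurable B & A = (fun x => x i) @^-1` B].

Local Notation seqT := (g_sigma_algebraType cylinders).

Lemma measurable_coord (i : nat) : measurable_fun [set: seqT] (fun x : seqT => x i).
Proof. by move=> _ B mB; rewrite setTI; apply: sub_sigma_algebra; exists i, B. Qed.

Lemma measurable_seqP d (T : measurableType d) (f : T -> seqT) :
  (forall i, measurable_fun [set: T] (fun t => f t i)) -> measurable_fun [set: T] f.
Proof.
move=> mf; apply: (@measurability _ _ T seqT setT f cylinders) => // _ [_ [i [B mB ->]] <-].
exact: mf.
Qed.

Lemma measurable_scons :
  measurable_fun [set: measurableTypeR R * seqT]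
    (fun p : measurableTypeR R * seqT => scons p.1 p.2 : seqT).
Proof.
apply: measurable_seqP => -[|i] /=; first exact: measurable_fst.
by apply: (measurableT_comp (measurable_coord i)); exact: measurable_snd.
Qed.

Lemma measurable_scons2 (t : R) :
  measurable_fun [set: seqT] (fun y : seqT => scons t y : seqT).
Proof.
by apply: measurable_seqP => -[|i] /=; [exact: measurable_cst|exact: measurable_coord].
Qed.

Lemma cube_int_ge0 (k : nat) (F : seqT -> \bar R) :
  (forall x, 0 <= F x)%E -> (0 <= cube_int k F)%E.
Proof.
elim: k F => [|k IH] F F0 /=; first exact: F0.
by apply: integral_ge0 => t _; apply: IH => y; exact: F0.
Qed.

(** The measure is the law of k independent uniform variables followed by zeros: a Dirac mass in
    dimension 0, then the push-forward under [scons] of the uniform law times the previous measure.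
    Tonelli gives the equality for nonnegative integrands. *)
Lemma cube_int_prob (k : nat) : exists mu : probability seqT R,
  forall F : seqT -> \bar R, measurable_fun setT F -> (forall x, 0 <= F x)%E ->
    cube_int k F = (\int[mu]_x F x)%E.
Proof.
elim: k => [|k [mu IH]].
  exists (\d_ ((fun=> 0) : seqT)) => F mF F0 /=.
  by rewrite integral_dirac// diracT mul1e.
pose nu := (uniform_prob (@ltr01 R) \x mu)%E.
pose sc (p : measurableTypeR R * seqT) : seqT := scons p.1 p.2.
have msc : measurable_fun setT sc by exact: measurable_scons.
pose mm0 : {measure set seqT -> \bar R} := pushforward nu sc.
pose mm := mm0 msc.
have mmT : mm setT = 1%E.
  rewrite /mm /mm0 /= /pushforward preimage_setT -setXTT product_measure1E//.
  rewrite [X in (X * _)%E](probability_setT (uniform_prob (@ltr01 R))).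
  by rewrite [X in (_ * X)%E](probability_setT mu) mule1.
exists (prob_of_measure mmT) => F mF F0 /=.
rewrite (eq_measure_integral mm)//.
rewrite ge0_integral_pushforward//=.
rewrite preimage_setT fubini_tonelli1//; last first.
  by apply: measurableT_comp; last exact: measurable_scons.
rewrite integral_uniform.
- rewrite subr0 invr1 mul1e; apply: eq_integral => t _ /=.
  by rewrite /fubini_F IH//; exact: measurableT_comp (measurable_scons2 t).
- apply: measurable_fun_fubini_tonelli_F => //.
  by apply: measurableT_comp; last exact: measurable_scons.
- by move=> t; apply: integral_ge0.
Qed.

Lemma measurable_cube_int d (T : measurableType d) (k : nat) (F : T -> seqT -> \bar R) :
  measurable_fun [set: T * seqT] (fun p => F p.1 p.2) ->
  (forall t x, 0 <= F t x)%E ->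
  measurable_fun [set: T] (fun t => cube_int k (F t)).
Proof.
move=> mF F0; have [mu muE] := cube_int_prob k.
rewrite (_ : (fun t => _) = (fun t => \int[mu]_x F t x)%E); last first.
  by apply/funext => t; rewrite muE//; exact: measurableT_comp mF (pair1_measurable t).
exact: (measurable_fun_fubini_tonelli_F (fun p => F p.1 p.2)).
Qed.

Lemma measurable_cube_int_scons (k : nat) (F : seqT -> \bar R) :
  measurable_fun setT F -> (forall x, 0 <= F x)%E ->
  measurable_fun [set: measurableTypeR R] (fun t => cube_int k (fun y => F (scons t y))).
Proof.
move=> mF F0; apply: (@measurable_cube_int _ (measurableTypeR R) k (fun t y => F (scons t y))) => //.
exact: (measurableT_comp mF measurable_scons).
Qed.

End seq_space.
Notation seqT R := (g_sigma_algebraType (@cylinders R)).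

(** * Change of variables on an interval *)

Section density.
Local Open Scope ereal_scope.
Context d (T : measurableType d) (R : realType).
Variables (mu : {measure set T -> \bar R}) (g : T -> R).

(** Made into a measure so that a change of variables becomes an equality of two measures, which can
    be tested on a generating family. *)
Definition mdensity (mg : measurable_fun setT g) (g0 : forall x, (0 <= g x)%R)
  (A : set T) : \bar R := \int[mu]_(x in A) (g x)%:E.

Variables (mg : measurable_fun setT g) (g0 : forall x, (0 <= g x)%R).

Let mdensity0 : mdensity mg g0 set0 = 0.
Proof. by rewrite /mdensity integral_set0. Qed.

Let mdensity_ge0 A : 0 <= mdensity mg g0 A.
Proof. by apply: integral_ge0 => x _; rewrite lee_fin. Qed.

Let mdensity_sigma_additive : semi_sigma_additive (mdensity mg g0).
Proof.
move=> /= F mF tF mUF; rewrite /mdensity; apply: cvg_toP.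
  apply: ereal_nondecreasing_is_cvgn => m n mn.
  by apply: lee_sum_nneg_natr => // k _ _; apply: integral_ge0 => x _; rewrite lee_fin.
rewrite ge0_integral_bigcup//= => [|x _]; last by rewrite lee_fin.
by apply: measurable_funTS; exact/measurable_EFinP.
Qed.

HB.instance Definition _ := isMeasure.Build _ _ _ (mdensity mg g0)
  mdensity0 mdensity_ge0 mdensity_sigma_additive.

Let integral_mdensity_indic E : measurable E ->
  \int[mdensity mg g0]_x (\1_E x)%:E = \int[mu]_x ((\1_E x)%:E * (g x)%:E).
Proof.
move=> mE; rewrite integral_indic//= /mdensity setIT integral_mkcond.
by apply: eq_integral => x _; rewrite epatch_indic muleC.
Qed.

Import HBNNSimple.

Let integral_mdensity_nnsfun (f : {nnsfun T >-> R}) :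
  \int[mdensity mg g0]_x (f x)%:E = \int[mu]_x ((f x)%:E * (g x)%:E).
Proof.
under [LHS]eq_integral do rewrite fimfunE -fsumEFin//.
rewrite [LHS]ge0_integral_fsum//; last 2 first.
  - by move=> r; exact/measurable_EFinP/measurableT_comp.
  - by move=> n x _; rewrite EFinM nnfun_muleindic_ge0.
under [RHS]eq_integral.
  move=> x xD; rewrite fimfunE -fsumEFin// ge0_mule_fsuml; last first.
    by move=> r; rewrite EFinM nnfun_muleindic_ge0.
  over.
rewrite [RHS]ge0_integral_fsum//; last 2 first.
  - move=> r; apply: emeasurable_funM; last exact/measurable_EFinP.
    exact/measurable_EFinP/measurableT_comp.
  - by move=> n x _; rewrite mule_ge0 ?lee_fin//; have := nnfun_muleindic_ge0 f n x; rewrite -EFinM lee_fin.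
apply: eq_fsbigr => r _; rewrite integralZl_indic_nnsfun//=.
have [r0|r0] := leP 0%R r; last first.
  rewrite preimage_nnfun0// indic0 /=.
  rewrite [X in _ * X](_ : _ = 0); last by apply: integral0_eq.
  by rewrite mule0; apply/esym/integral0_eq => x _; rewrite mulr0 mul0e.
rewrite integral_mdensity_indic//.
under [RHS]eq_integral do rewrite EFinM -muleA.
rewrite ge0_integralZl//.
- apply: emeasurable_funM; last exact/measurable_EFinP.
  by apply/measurable_EFinP; exact: measurable_indic.
- by move=> x _; rewrite mule_ge0// lee_fin.
Qed.

Lemma integral_mdensity (f : T -> \bar R) :
  measurable_fun setT f -> (forall x, 0 <= f x) ->
  \int[mdensity mg g0]_x f x = \int[mu]_x (f x * (g x)%:E).
Proof.
move=> mf f0.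
pose f_ := nnsfun_approx measurableT mf.
transitivity (lim (\int[mdensity mg g0]_x (f_ n x)%:E @[n --> \oo])).
  rewrite -monotone_convergence//=.
  - apply: eq_integral => ? /[!inE] xD; apply/esym/cvg_lim => //=.
    exact: cvg_nnsfun_approx.
  - by move=> n; exact/measurable_EFinP/measurable_funTS.
  - by move=> n ? _; rewrite lee_fin.
  - by move=> ? _ ? ? mn; rewrite lee_fin; exact/lefP/nd_nnsfun_approx.
under eq_fun do rewrite integral_mdensity_nnsfun.
rewrite -monotone_convergence//=.
- apply: eq_integral => x _.
  have fx : (f_ n x)%:E @[n --> \oo] --> f x by exact: cvg_nnsfun_approx.
  have cf : cvgn (fun n => (f_ n x)%:E) by apply/cvg_ex; exists (f x).
  under eq_fun do rewrite muleC.
  by rewrite limeMl// (cvg_lim _ fx)// muleC.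
- move=> n; apply: emeasurable_funM; last exact/measurable_EFinP.
  exact/measurable_EFinP/measurable_funTS.
- by move=> n ? _; rewrite mule_ge0// lee_fin.
- move=> ? _ ? ? mn; rewrite lee_wpmul2r ?lee_fin//.
  exact/lefP/nd_nnsfun_approx.
Qed.

End density.

Section substitution.
Context {R : realType}.
Notation mu := (@lebesgue_measure R).
Variables (a b : R) (psi dpsi : R -> R).
Hypotheses (ab : a < b) (mpsi : measurable_fun setT psi)
  (mdpsi : measurable_fun setT dpsi)
  (psiD : forall y, y \in `[a, b] -> is_derive y 1 psi (dpsi y))
  (cdpsi : {within `[a, b], continuous dpsi})
  (dpsi_gt0 : forall y, y \in `[a, b] -> 0 < dpsi y).

Let cpsi : {within `[a, b], continuous psi}.
Proof.
by apply: derivable_within_continuous => y yab; have [] := psiD yab.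
Qed.

Let psi_incr x y : a <= x -> x < y -> y <= b -> psi x < psi y.
Proof.
apply: gtr0_derive1_incr => //.
- by move=> z /subset_itv_oo_cc zab; have [] := psiD zab.
- by move=> z /subset_itv_oo_cc zab; have [? E] := psiD zab; rewrite derive1E E dpsi_gt0.
Qed.

Let psi_ndecr x y : a <= x -> x <= y -> y <= b -> psi x <= psi y.
Proof.
by move=> ax; rewrite le_eqVlt => /predU1P[->//|xy] yb; exact/ltW/psi_incr.
Qed.

Let ftc z : a <= z -> z < b ->
  (\int[mu]_(y in `[z, b]) (dpsi y)%:E = (psi b - psi z)%:E)%E.
Proof.
move=> az zb; have sub : `[z, b] `<=` `[a, b] by apply: subset_itvr; rewrite bnd_simp.
rewrite (@continuous_FTC2 _ dpsi psi) ?EFinB//.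
- exact: continuous_subspaceW cdpsi.
- have /(continuous_within_itvP _ zb)[_ h1 h2] : {within `[z, b], continuous psi}.
    exact: continuous_subspaceW cpsi.
  split => // y /subset_itv_oo_cc yzb.
  by have [] := psiD (sub _ yzb).
- move=> y /subset_itv_oo_cc yzb.
  by have [? E] := psiD (sub _ yzb); rewrite derive1E E.
Qed.

Let g (y : R) := dpsi y * \1_(`[a, b]) y.
Let g' (x : R) : R := \1_(`[psi a, psi b]) x.

Let mg : measurable_fun setT g.
Proof. by apply: measurable_funM => //; exact: measurable_indic. Qed.

Let mg' : measurable_fun setT g'.
Proof. exact: measurable_indic. Qed.

Let g0 y : 0 <= g y.
Proof.
rewrite /g indicE; case: (boolP (y \in _)) => [|_]; last by rewrite mulr0.
by rewrite inE/= => /dpsi_gt0/ltW; rewrite mulr1.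
Qed.

Let g'0 y : 0 <= g' y.
Proof. by rewrite /g'. Qed.

Let m1 : {measure set (measurableTypeR R) -> \bar R} := mdensity mu mg' g'0.
Let m2 : {measure set (measurableTypeR R) -> \bar R}.
Proof.
pose m : {measure set (measurableTypeR R) -> \bar R} :=
  pushforward (mdensity mu mg g0) (psi : _ -> measurableTypeR R).
exact: (m mpsi).
Defined.

(** The two measures are compared on the rays ]x, +oo[, which are stable under intersection and
    generate the Borel sets. There the equality is the fundamental theorem of calculus between z and
    b, where psi z = x; rays starting outside [psi a, psi b[ give everything or nothing. *)
Lemma subst_measureE A : measurable A -> m1 A = m2 A.
Proof.
have m2E B : m2 B = (\int[mu]_(y in psi @^-1` B `&` `[a, b]) (dpsi y)%:E)%E.
  rewrite /m2/= /pushforward /mdensity integral_mkcondr.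
  apply: eq_integral => y _; rewrite patchE /g indicE.
  by case: ifP => _; rewrite ?mulr1 ?mulr0.
have m1E B : measurable B -> m1 B = mu (`[psi a, psi b] `&` B).
  by move=> mB; rewrite /m1/= /mdensity integral_indic.
move: A; apply: (@measure_unique _ R (measurableTypeR R) (@RGenOInfty.G R) (fun n => `]- n%:R, +oo[%classic)).
- exact: RGenOInfty.measurableE.
- move=> _ _ [x ->] [y ->]; exists (Num.max x y).
  by apply/seteqP; split=> z /=; rewrite !in_itv/= !andbT gt_max => /andP.
- by move=> n; exists (- n%:R).
- apply/seteqP; split=> // x _; exists (Num.truncn `|x|).+1 => //=.
  rewrite in_itv/= andbT; apply: lt_le_trans (lerNnormlW (lexx _)).
  by rewrite ltrN2 truncnS_gt.
- move=> _ [x ->]; rewrite m1E// m2E.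
  have [xb|bx] := ltP x (psi b); last first.
    rewrite [X in mu X](_ : _ = set0) ?measure0; last first.
      apply/seteqP; split=> z //=; rewrite !in_itv/= andbT => -[/andP[_ zb]].
      by move/(le_lt_trans (le_trans zb bx)); rewrite ltxx.
    rewrite [X in (\int[_]_(_ in X) _)%E](_ : _ = set0) ?integral_set0//.
    apply/seteqP; split=> z //=; rewrite !in_itv/= andbT => -[xz /andP[az zb]].
    by have := lt_le_trans xz (le_trans (psi_ndecr az zb (lexx b)) bx); rewrite ltxx.
  have [xa|ax] := ltP x (psi a).
    rewrite [X in mu X](_ : _ = `[psi a, psi b]%classic); last first.
      apply/seteqP; split=> z /=; rewrite !in_itv/= andbT; first by case.
      by move=> /andP[az zb]; split; [rewrite az|exact: lt_le_trans az].
    rewrite lebesgue_measure_itv/= lte_fin psi_incr// -EFinB -ftc//.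
    congr (integral _ _ _); apply/seteqP; split=> z /=; rewrite !in_itv/= ?andbT; last by case.
    by move=> /andP[az zb]; split; [apply: lt_le_trans xa _; exact: psi_ndecr|rewrite az].
  have [z zab zx] : exists2 z, z \in `[a, b] & psi z = x.
    apply: IVT; [exact: ltW|exact: cpsi|].
    by rewrite ge_min ax/= le_max (ltW xb) orbT.
  move: zab; rewrite in_itv/= => /andP[az].
  rewrite le_eqVlt => /predU1P[zb|zb]; first by move: xb; rewrite -zx zb ltxx.
  rewrite [X in mu X](_ : _ = `]x, psi b]%classic); last first.
    apply/seteqP; split=> y /=; rewrite !in_itv/= andbT; first by move=> [/andP[_ ->] ->].
    by move=> /andP[xy yb]; split=> //; rewrite yb (le_trans ax (ltW xy)).
  rewrite lebesgue_measure_itv/= lte_fin xb -EFinB -zx -ftc//.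
  rewrite -integral_itv_obnd_cbnd; last first.
    by apply/measurable_EFinP; exact: measurable_funTS.
  congr (integral _ _ _); apply/seteqP; split=> y /=; rewrite !in_itv/= ?andbT.
    move=> /andP[zy yb]; split; first exact: psi_incr.
    by rewrite yb (le_trans az (ltW zy)).
  move=> [zy /andP[ay yb]]; rewrite yb andbT ltNge; apply/negP => yz.
  by have := lt_le_trans zy (psi_ndecr ay yz (ltW zb)); rewrite ltxx.
- move=> n; rewrite m1E//; apply: le_lt_trans (_ : mu `[psi a, psi b] < +oo)%E.
    by apply: le_measure; rewrite ?inE//; exact: measurableI.
  by rewrite lebesgue_measure_itv/= lte_fin psi_incr// -EFinB ltry.
Qed.

(** Only measurability of [h] is assumed: it will be a partial integral of a singular weight, about
    which continuity is not known. *)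
Lemma increasing_ge0_measurable_substitution (h : R -> \bar R) :
  measurable_fun setT h -> (forall x, 0 <= h x)%E ->
  (\int[mu]_(x in `[psi a, psi b]) h x =
   \int[mu]_(y in `[a, b]) (h (psi y) * (dpsi y)%:E))%E.
Proof.
move=> mh h0.
have -> : (\int[mu]_(x in `[psi a, psi b]) h x = \int[m1]_x h x)%E.
  rewrite integral_mdensity// [LHS]integral_mkcond.
  by congr (integral _ _ _); exact: (epatch_indic h).
rewrite (eq_measure_integral m2); last by move=> A mA _; exact: subst_measureE.
rewrite ge0_integral_pushforward//= preimage_setT integral_mdensity//; last first.
  exact: measurableT_comp.
rewrite [RHS]integral_mkcond; congr (integral _ _ _); apply/funext => y /=.
by rewrite /g EFinM muleA; exact/esym/(congr1 (@^~ y) (epatch_indic _ _)).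
Qed.

End substitution.

(** * The substitution on the cube *)

Section inverse.
Context {R : realType}.

(** Measurability of real powers is available, but [powR] gives the inverse only on nonnegative
    reals. Writing 1/x as x times (x^2)^(-1) also covers negative x, and both sides are 0 at x =
    0. *)
Lemma measurable_inv : measurable_fun [set: R] (@GRing.inv R).
Proof.
rewrite (_ : GRing.inv = (fun x : R => x * (x ^+ 2) `^ (-1))).
  apply: measurable_funM => //.
  have m2 : measurable_fun [set: R] (fun x : R => x ^+ 2) by exact: measurable_funX.
  exact: (measurableT_comp (@measurable_powR R (-1)) m2).
apply/funext => x; have [->|x0] := eqVneq x 0; first by rewrite invr0 mul0r.
by rewrite powR_inv1 ?sqr_ge0// expr2 invfM mulrA mulfV// mul1r.
Qed.

Lemma measurable_funV d (T : measurableType d) (f : T -> R) :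
  measurable_fun setT f -> measurable_fun setT (fun x => (f x)^-1).
Proof. exact: (measurableT_comp measurable_inv). Qed.

End inverse.

Section cube_substitution.
Context {R : realType}.
Notation mu := (@lebesgue_measure R).

Lemma cube_intZl (k : nat) (r : R) (F : seqT R -> \bar R) :
  measurable_fun setT F -> (forall x, 0 <= F x)%E -> (0 <= r)%R ->
  cube_int k (fun x => r%:E * F x)%E = (r%:E * cube_int k F)%E.
Proof.
elim: k F => [//|k IH] F mF F0 r0 /=.
under eq_integral.
  move=> t _; rewrite IH//; last exact: measurableT_comp mF (measurable_scons2 t).
  over.
rewrite ge0_integralZl//.
- by apply: measurable_funTS; exact: measurable_cube_int_scons.
- by move=> t _; exact: cube_int_ge0.
Qed.

Definition jshift (c d s y : R) : R := y - s * (1 - y) * (c + d / y).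
Definition dshift (c d s y : R) : R := 1 + s * (c + d / y ^+ 2).
(** The zero branch discards the points that the shift sends below 0, so that the substituted
    integral still runs over all of [0,1]. The point y = 0, where d/y takes a default value, is
    discarded as well. *)
Definition jac (c d s y : R) : R :=
  if (0 < y) && (0 <= jshift c d s y) then dshift c d s y else 0.

Variables (c d s : R).
Hypotheses (c0 : 0 <= c) (d0 : 0 <= d) (cd0 : 0 < c + d) (s0 : 0 < s).

Lemma shiftB (y z : R) : y != 0 -> z != 0 ->
  jshift c d s y - jshift c d s z = (y - z) * (1 + s * (c + d / (y * z))).
Proof. by move=> y0 z0; rewrite /jshift; field; rewrite y0 z0. Qed.

Lemma measurable_shift : measurable_fun setT (jshift c d s).
Proof.
apply: measurable_funB => //; apply: measurable_funM.
  by apply: measurable_funM => //; exact: measurable_funB.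
by apply: measurable_funD => //; apply: measurable_funM => //; exact: measurable_funV.
Qed.

Lemma measurable_dshift : measurable_fun setT (dshift c d s).
Proof.
apply: measurable_funD => //; apply: measurable_funM => //.
apply: measurable_funD => //; apply: measurable_funM => //.
by apply: measurable_funV; exact: measurable_funX.
Qed.

Lemma measurable_jac : measurable_fun setT (jac c d s).
Proof.
apply: measurable_fun_ifT => //; last exact: measurable_dshift.
apply: measurable_and; first exact: measurable_fun_ltr.
by apply: measurable_fun_ler => //; exact: measurable_shift.
Qed.

Lemma jac_ge0 y : 0 <= jac c d s y.
Proof.
rewrite /jac; case: ifP => // _.
by rewrite /dshift addr_ge0// mulr_ge0 ?(ltW s0)// addr_ge0// divr_ge0// sqr_ge0.
Qed.

Lemma shift_is_derive (y : R) : y != 0 ->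
  is_derive y 1 (jshift c d s) (dshift c d s y).
Proof.
move=> y0.
have dV : is_derive y 1 (fun z : R => z^-1) (- (y ^- 2) *: 1).
  exact: (@is_deriveV _ id y 1 1).
rewrite (_ : jshift c d s = (fun z => z - s * (1 - z) * (c + d * z^-1)))//.
apply: is_derive_eq.
by rewrite /GRing.scale/= /dshift; field.
Qed.

Lemma derivable_dshift (y : R) : y != 0 -> derivable (dshift c d s) y 1.
Proof.
move=> y0.
have dV : derivable (fun z : R => (z ^+ 2)^-1) y 1.
  by apply: derivableV; [rewrite expf_neq0|exact: exprn_derivable].
change (derivable (cst 1 + cst s * (cst c + cst d * (fun z : R => (z ^+ 2)^-1))) y 1).
apply: derivableD; first exact: derivable_cst.
apply: derivableM; first exact: derivable_cst.
apply: derivableD; first exact: derivable_cst.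
by apply: derivableM; first exact: derivable_cst.
Qed.

Lemma shift_root : exists l, [/\ 0 < l, l < 1 & jshift c d s l = 0].
Proof.
pose m := s * (c + d); have m0 : 0 < m by rewrite mulr_gt0.
(* This [e] solves e = s (1 - e)(c + d). Since e < 1, replacing d by d/e can only lower the shift,
   so its value at [e] is at most 0. *)
pose e := m / (1 + m).
have e0 : 0 < e by rewrite divr_gt0// addr_gt0.
have e1 : e < 1 by rewrite ltr_pdivrMr ?addr_gt0// mul1r ltrDr.
have se : jshift c d s e <= 0.
  rewrite /jshift subr_le0.
  have {1}-> : e = s * (1 - e) * (c + d).
    by rewrite /e /m; field; rewrite -/m gt_eqF// addr_gt0.
  rewrite ler_pM2l ?mulr_gt0 ?subr_gt0// lerD2l ler_peMr// -[leLHS]invr1.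
  by rewrite lef_pV2 ?posrE// ltW.
have s1 : jshift c d s 1 = 1 by rewrite /jshift subrr mulr0 mul0r subr0.
have [l lE l0] : exists2 l, l \in `[e, 1] & jshift c d s l = 0.
  apply: IVT; first exact: ltW.
    apply: derivable_within_continuous => y; rewrite in_itv/= => /andP[ey _].
    by have [] := shift_is_derive (lt0r_neq0 (lt_le_trans e0 ey)).
  by rewrite s1 ge_min se/= le_max ler01 orbT.
exists l; move: lE; rewrite in_itv/= => /andP[el l1]; split => //.
  exact: lt_le_trans el.
rewrite lt_neqAle l1 andbT; apply/eqP => l1E; move: l0; rewrite l1E s1.
by move/eqP; rewrite oner_eq0.
Qed.

Lemma shift_substitution (h : R -> \bar R) :
  measurable_fun setT h -> (forall x, 0 <= h x)%E ->
  (\int[mu]_(x in `[0%R, 1%R]) h x =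
   \int[mu]_(y in `[0%R, 1%R]) (h (jshift c d s y) * (jac c d s y)%:E))%E.
Proof.
move=> mh h0; have [l [l0 l1 sl]] := shift_root.
have s1 : jshift c d s 1 = 1 by rewrite /jshift subrr mulr0 mul0r subr0.
(* By [shiftB] at the root l, the shift of y is (y - l) times a positive factor, so the test inside
   [jac] is exactly l <= y. *)
have pos y : 0 < y -> l <= y = (0 <= jshift c d s y).
  move=> y0; have := shiftB (lt0r_neq0 y0) (lt0r_neq0 l0).
  rewrite sl subr0 => ->; rewrite pmulr_lge0 ?subr_ge0//.
  by rewrite ltr_pwDl// mulr_ge0 ?(ltW s0)// addr_ge0// divr_ge0// mulr_ge0// ltW.
have gtl y : y \in `[l, 1] -> y != 0.
  by rewrite in_itv/= => /andP[ly _]; rewrite gt_eqF// (lt_le_trans l0).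
have D1 y : y \in `[l, 1] -> is_derive y 1 (jshift c d s) (dshift c d s y).
  by move=> /gtl; exact: shift_is_derive.
have D2 : {within `[l, 1], continuous (dshift c d s)}.
  by apply: derivable_within_continuous => y /gtl; exact: derivable_dshift.
have D3 y : y \in `[l, 1] -> 0 < dshift c d s y.
  move=> /gtl y0.
  by rewrite /dshift ltr_pwDl// mulr_ge0 ?(ltW s0)// addr_ge0// divr_ge0// sqr_ge0.
have := @increasing_ge0_measurable_substitution R l 1 (jshift c d s) (dshift c d s)
  l1 measurable_shift measurable_dshift D1 D2 D3 h mh h0.
rewrite sl s1 => ->.
rewrite integral_mkcond [RHS]integral_mkcond; apply: eq_integral => y _.
rewrite !patchE; case: ifPn; rewrite ?inE ?notin_setE/= in_itv/=.
  move=> /andP[ly y1]; have y0 := lt_le_trans l0 ly.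
  by rewrite mem_set/= ?in_itv/= ?(ltW y0)// /jac y0 -pos// ly.
move=> /negP; rewrite negb_and -!ltNge => ly; case: ifPn => //.
rewrite inE/= in_itv/= => /andP[y0 y1].
have {}ly : y < l by case/orP: ly => //; rewrite ltNge y1.
rewrite /jac; case: (ltP 0 y) => //=; last by rewrite mule0.
by move=> /pos <-; rewrite leNgt ly mule0.
Qed.

Definition shiftn (k : nat) (y : nat -> R) : nat -> R :=
  fun i => if (i < k)%N then jshift c d s (y i) else y i.

Lemma measurable_shiftn (k : nat) : measurable_fun setT (shiftn k : seqT R -> seqT R).
Proof.
apply: measurable_seqP => i; rewrite /shiftn; case: (i < k)%N; last exact: measurable_coord.
exact: measurableT_comp measurable_shift (measurable_coord i).
Qed.

Lemma measurable_prod_jac (k : nat) :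
  measurable_fun setT (fun y : seqT R => \prod_(i < k) jac c d s (y i)).
Proof.
apply: measurable_prod => i _.
exact: measurableT_comp measurable_jac (measurable_coord i).
Qed.

(** The shift acts on each coordinate separately: the one-variable substitution handles the outer
    integral, induction the inner one, and the outer Jacobian is a constant that is moved inside. *)
Lemma cube_substitution (k : nat) (F : seqT R -> \bar R) :
  measurable_fun setT F -> (forall x, 0 <= F x)%E ->
  cube_int k F = cube_int k (fun y =>
    (F (shiftn k y) * (\prod_(i < k) jac c d s (y i))%:E)%E).
Proof.
elim: k F => [|k IH] F mF F0 /=.
  by rewrite big_ord0 mule1; congr F; apply/funext.
rewrite shift_substitution; last 2 first.
- exact: measurable_cube_int_scons.
- by move=> t; exact: cube_int_ge0.
apply: eq_integral => t _; rewrite IH//; last exact: measurableT_comp mF (measurable_scons2 _).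
rewrite muleC -cube_intZl; last 3 first.
- apply: emeasurable_funM; last by apply/measurable_EFinP; exact: measurable_prod_jac.
  exact: (measurableT_comp mF (measurableT_comp (measurable_scons2 _) (measurable_shiftn k))).
- by move=> x; rewrite mule_ge0// lee_fin prodr_ge0// => i _; exact: jac_ge0.
- exact: jac_ge0.
congr cube_int; apply/funext => y; rewrite big_ord_recl/= EFinM muleCA.
by congr (F _ * _)%E; apply/funext => -[|i].
Qed.

End cube_substitution.

(** * Symmetry of the iterated integral *)

Section cube_symmetry.
Context {R : realType}.
Notation mu := (@lebesgue_measure R).

Let integral_itv01 (f : R -> \bar R) : measurable_fun setT f -> (forall x, 0 <= f x)%E ->
  (\int[mu]_(x in `[0%R, 1%R]) f x = \int[uniform_prob (@ltr01 R)]_x f x)%E.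
Proof. by move=> mf f0; rewrite integral_uniform// subr0 invr1 mul1e. Qed.

Definition adjswap (k : nat) (x : nat -> R) : nat -> R :=
  fun i => if i == k then x k.+1 else if i == k.+1 then x k else x i.

(** Adjacent swaps fit the nesting of the integrals: swapping the two outermost variables is
    Tonelli, and any other adjacent swap happens inside the outer integral. A chain of them moves
    any coordinate to the front. *)
Lemma cube_int_adjswap (n k : nat) (F : seqT R -> \bar R) : (k.+1 < n)%N ->
  measurable_fun setT F -> (forall x, 0 <= F x)%E ->
  cube_int n (fun x => F (adjswap k x)) = cube_int n F.
Proof.
elim: k n F => [|k IH] [//|n] F kn mF F0.
  case: n kn => [//|n] _ /=.
  pose G (p : R * R) := cube_int n (fun y => F (scons p.1 (scons p.2 y))).
  have mG : measurable_fun setT G.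
    apply: (@measurable_cube_int R _ (measurableTypeR R * measurableTypeR R)%type n
       (fun p y => F (scons p.1 (scons p.2 y)))) => //.
    apply: (measurableT_comp mF); apply: measurable_seqP => -[|[|i]] /=.
    - exact: measurableT_comp measurable_fst measurable_fst.
    - exact: measurableT_comp measurable_snd measurable_fst.
    - exact: measurableT_comp (measurable_coord i) measurable_snd.
  have G0 p : (0 <= G p)%E by exact: cube_int_ge0.
  transitivity (\int[mu]_(t in `[0%R, 1%R]) \int[mu]_(u in `[0%R, 1%R]) G (u, t))%E.
    apply: eq_integral => t _; apply: eq_integral => u _.
    by congr cube_int; apply/funext => y; congr F; apply/funext => -[|[|i]].
  transitivity (\int[mu]_(t in `[0%R, 1%R]) \int[mu]_(u in `[0%R, 1%R]) G (t, u))%E; last by [].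
  have mG1 t : measurable_fun setT (fun u : R => G (t, u)).
    exact: measurableT_comp mG (pair1_measurable t).
  have mG2 t : measurable_fun setT (fun u : R => G (u, t)).
    exact: measurableT_comp mG (pair2_measurable t).
  under eq_integral do rewrite integral_itv01//.
  under [RHS]eq_integral do rewrite integral_itv01//.
  rewrite !integral_itv01.
  - by apply/esym; exact: (@fubini_tonelli _ _ (measurableTypeR R) (measurableTypeR R) R (uniform_prob (@ltr01 R)) (uniform_prob (@ltr01 R)) G mG G0).
  - exact: (@measurable_fun_fubini_tonelli_F _ _ (measurableTypeR R) (measurableTypeR R) R (uniform_prob (@ltr01 R)) G mG G0).
  - by move=> t; exact: integral_ge0.
  - exact: (@measurable_fun_fubini_tonelli_G _ _ (measurableTypeR R) (measurableTypeR R) R (uniform_prob (@ltr01 R)) G mG G0).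
  - by move=> t; exact: integral_ge0.
rewrite /=; apply: eq_integral => t _.
rewrite -(IH n (fun y => F (scons t y)))//; last exact: measurableT_comp mF (measurable_scons2 t).
by congr cube_int; apply/funext => y; congr F; apply/funext => -[|i].
Qed.

Lemma cube_int_symm (n i : nat) (F : nat -> seqT R -> \bar R) :
  (forall j, measurable_fun setT (F j)) -> (forall j x, 0 <= F j x)%E ->
  (forall j x, (j.+1 < n)%N -> F j.+1 x = F j (adjswap j x)) ->
  (i < n)%N -> cube_int n (F i) = cube_int n (F 0%N).
Proof.
move=> mF F0 FE; elim: i => [//|i IH] lin; rewrite -IH; last exact: ltnW.
rewrite -[RHS](cube_int_adjswap lin)//.
by congr cube_int; apply/funext => x; rewrite FE.
Qed.

End cube_symmetry.

(** * Lower bounds and divergence *)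

Section lower_bounds.
Context {R : realType}.
Notation mu := (@lebesgue_measure R).

Lemma integral_inv_pinfty (e : R) : 0 < e ->
  (\int[mu]_(x in `[0%R, e]) (x^-1)%:E = +oo)%E.
Proof.
move=> e0.
have minv D : measurable_fun D (fun x : R => (x^-1)%:E).
  by apply/measurable_EFinP/measurable_funTS; exact: measurable_inv.
have key t : 0 < t -> t < e -> ((ln e - ln t)%:E <= \int[mu]_(x in `[0%R, e]) (x^-1)%:E)%E.
  move=> t0 te; rewrite EFinB.
  have pos x : x \in `[t, e] -> 0 < x.
    by rewrite in_itv/= => /andP[tx _]; exact: lt_le_trans tx.
  have cln : {within `[t, e], continuous (@ln R)}.
    by apply: derivable_within_continuous => x /pos x0; have [] := is_derive1_ln x0.
  rewrite -(@continuous_FTC2 _ (fun x => x^-1) (@ln R))//.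
  - apply: ge0_subset_integral => //=.
    + exact: minv.
    + by move=> x; rewrite in_itv/= => /andP[x0 _]; rewrite lee_fin invr_ge0.
    + by apply: subset_itvr; rewrite bnd_simp ltW.
  - apply: derivable_within_continuous => x /pos x0; apply: derivableV => //.
    by rewrite gt_eqF.
  - have /(continuous_within_itvP _ te)[_ h1 h2] := cln.
    by split => // x /subset_itv_oo_cc/pos x0; have [] := is_derive1_ln x0.
  - move=> x /subset_itv_oo_cc/pos x0; have [_ E] := is_derive1_ln x0.
    by rewrite derive1E E.
have : (0 <= \int[mu]_(x in `[0%R, e]) (x^-1)%:E)%E.
  by apply: integral_ge0 => x/=; rewrite in_itv/= => /andP[x0 _]; rewrite lee_fin invr_ge0.
case: (\int[mu]_(x in _) _)%E key => [v|//|//] key; rewrite lee_fin => v0.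
(* If the integral were the finite number v, this lower end would give ln e - ln t = v + 1, hence v
   + 1 <= v. *)
have := key (e * expR (- (v + 1))).
rewrite mulr_gt0 ?expR_gt0// => /(_ isT).
rewrite gtr_pMr// expR_lt1 oppr_lt0 ltr_wpDl// => /(_ isT).
rewrite lnM ?posrE ?expR_gt0// expRK lee_fin opprD addrA subrr add0r opprK.
by rewrite gerDl ler10.
Qed.

Lemma cube_int_box_ge (m : nat) (lo : nat -> R) (dl r : R) (F : seqT R -> \bar R) :
  measurable_fun setT F -> (forall x, 0 <= F x)%E -> 0 <= r -> 0 < dl ->
  (forall i, (i < m)%N -> 0 <= lo i /\ lo i + dl <= 1) ->
  (forall x : nat -> R, (forall i, (i < m)%N -> lo i <= x i <= lo i + dl)%R -> r%:E <= F x)%E ->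
  ((r * dl ^+ m)%:E <= cube_int m F)%E.
Proof.
move=> + + r0 dl0; elim: m lo F => [|m IH] lo F mF F0 lo01 Fr /=.
  by rewrite expr0 mulr1; exact: Fr.
have [l0 l1] := lo01 0%N isT.
have -> : ((r * dl ^+ m.+1)%:E = \int[mu]_(t in `[lo 0%N, (lo 0%N + dl)%R]) (r * dl ^+ m)%:E)%E.
  rewrite integral_cst//= lebesgue_measure_itv/= lte_fin ltrDl dl0.
  by rewrite -EFinB -EFinM addrAC subrr add0r exprSr mulrA.
have mG : measurable_fun setT (fun t => cube_int m (fun y => F (scons t y))).
  exact: measurable_cube_int_scons.
have sub : `[lo 0%N, lo 0%N + dl] `<=` `[0, 1] by apply: subset_itv; rewrite bnd_simp.
have S : (\int[mu]_(t in `[lo 0%N, (lo 0%N + dl)%R]) cube_int m (fun y => F (scons t y)) <=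
    \int[mu]_(t in `[0%R, 1%R]) cube_int m (fun y => F (scons t y)))%E.
  apply: ge0_subset_integral => //=; first exact: measurable_funTS.
  by move=> t _; exact: cube_int_ge0.
refine (le_trans _ S).
apply: ge0_le_integral => //=.
- by move=> t _; rewrite lee_fin mulr_ge0// exprn_ge0// ltW.
- exact: measurable_funTS.
- move=> t; rewrite in_itv/= => tl.
  apply: (IH (fun i => lo i.+1)) => //.
  + exact: measurableT_comp mF (measurable_scons2 t).
  + by move=> i im; exact: lo01.
  + by move=> x xb; apply: Fr => -[//|i]; exact: xb.
Qed.

(** A uniform positive lower bound in existential form, so that it passes through the products of
    the weight without tracking constants. *)
Definition ge_pos (S : set (nat -> R)) (F : (nat -> R) -> R) :=
  exists2 c, 0 < c & forall x, S x -> c <= F x.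

Lemma ge_posM S F G : ge_pos S F -> ge_pos S G -> ge_pos S (fun x => F x * G x).
Proof.
move=> [c c0 cF] [e e0 eG]; exists (c * e); first exact: mulr_gt0.
by move=> x Sx; apply: ler_pM; rewrite ?(ltW c0) ?(ltW e0) ?cF ?eG.
Qed.

Lemma ge_pos_prod S (I : finType) (P : pred I) (F : I -> (nat -> R) -> R) :
  (forall i, P i -> ge_pos S (F i)) -> ge_pos S (fun x => \prod_(i | P i) F i x).
Proof.
move=> h; rewrite (_ : (fun x => _) = \big[(fun F G x => F x * G x)/(fun=> 1)]_(i | P i) F i).
  apply: (big_ind (ge_pos S)) => //; first by exists 1.
  exact: ge_posM.
by apply/funext => x; rewrite (big_morph (fun G : (nat -> R) -> R => G x) (id1 := 1) (op1 := *%R)).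
Qed.

(** The lower bound on [f] serves for p >= 0; for p < 0 it is the upper bound 1 that makes the power
    at least 1. *)
Lemma ge_pos_powR S (f : (nat -> R) -> R) (p dl : R) : 0 < dl ->
  (forall x, S x -> dl <= f x <= 1) -> ge_pos S (fun x => f x `^ p).
Proof.
move=> dl0 h; have [p0|p0] := leP 0 p.
  exists (dl `^ p); first exact: powR_gt0.
  move=> x /h/andP[dx _]; apply: ge0_ler_powR; rewrite ?nnegrE ?(ltW dl0)//.
  exact: ltW (lt_le_trans dl0 dx).
exists 1 => // x /h/andP[dx x1]; have x0 := lt_le_trans dl0 dx.
rewrite -(opprK p) powRN invf_ge1 ?powR_gt0//.
rewrite -[leRHS](congr1 (@^~ (- p)) (powR1 R)); apply: ge0_ler_powR; rewrite ?nnegrE ?ler01 ?(ltW x0)//.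
by rewrite oppr_ge0 ltW.
Qed.

(** With d = 1/(2n + 2), coordinate i ranges over [2 i d, (2 i + 1) d]. Different coordinates stay
    at distance at least d from each other, all stay at least d away from 1, and only x_0 can come
    close to 0. *)
Definition box (n : nat) : set (nat -> R) :=
  [set x | forall i, (i < n)%N -> 2 * i%:R / (2 * n%:R + 2) <= x i <= (2 * i%:R + 1) / (2 * n%:R + 2)].

Let dl (n : nat) : R := (2 * n%:R + 2)^-1.

Let dl_gt0 n : 0 < dl n.
Proof. by rewrite invr_gt0 ltr_wpDl// mulr_ge0. Qed.

Let dlE n : 1 = 2 * (n%:R * dl n) + 2 * dl n.
Proof. by rewrite /dl; field; rewrite gt_eqF// ltr_wpDl// mulr_ge0. Qed.

Lemma jacobi_weight_box (n : nat) (a b g : R) : exists2 c, 0 < c &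
  forall x, box n.+1 x -> c * x 0%N `^ (a - 1) <= jacobi_weight n.+1 a b g x.
Proof.
pose d := dl n.+1; have d0 : 0 < d by exact: dl_gt0.
have dE := dlE n.+1; rewrite -/d -natr1 in dE.
have xb x i : box n.+1 x -> (i < n.+1)%N ->
    [/\ 2 * (i%:R * d) <= x i, x i <= 2 * (i%:R * d) + d & i%:R * d <= n%:R * d].
  move=> bx lin; have [h1 h2] := andP (bx _ lin).
  split; [by rewrite mulrA|by rewrite mulrA -[X in _ + X]mul1r -mulrDl|].
  by rewrite ler_pM2r// ler_nat.
have i0 i : 0 <= i%:R * d :> R by rewrite mulr_ge0// ltW.
have [c c0 hc] : ge_pos (box n.+1) (fun x =>
    (\prod_(i < n.+1) \prod_(j < n.+1 | (i < j)%N) (`|x i - x j| `^ (2 * g)))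
    * (\prod_(i < n) (x i.+1 `^ (a - 1)))
    * (\prod_(i < n.+1) ((1 - x i) `^ (b - 1)))).
  apply: ge_posM; first apply: ge_posM.
  - apply: ge_pos_prod => i _; apply: ge_pos_prod => j ij.
    apply: (@ge_pos_powR _ _ _ d) => // x bx.
    have [h1 h2 h3] := xb _ _ bx (ltn_ord i); have [h4 h5 h6] := xb _ _ bx (ltn_ord j).
    have ijd : i%:R * d + d <= j%:R * d :> R.
      by rewrite -[X in _ + X]mul1r -mulrDl natr1 ler_pM2r// ler_nat.
    have := i0 i; have := i0 j.
    by rewrite distrC ger0_norm; lra.
  - apply: ge_pos_prod => i _; apply: (@ge_pos_powR _ _ _ d) => // x bx.
    have [h1 h2 h3] := xb _ i.+1 bx (ltn_ord i); have := i0 i; move: h1 h2 h3.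
    by rewrite -natr1 mulrDl mul1r; lra.
  - apply: ge_pos_prod => i _; apply: (@ge_pos_powR _ _ _ d) => // x bx.
    have [h1 h2 h3] := xb _ _ bx (ltn_ord i); have := i0 i; lra.
exists c => // x bx; rewrite /jacobi_weight [X in _ * X * _]big_ord_recl/=.
rewrite [leRHS](_ : _ = (\prod_(i < n.+1) \prod_(j < n.+1 | (i < j)%N) (`|x i - x j| `^ (2 * g)))
    * (\prod_(i < n) (x i.+1 `^ (a - 1)))
    * (\prod_(i < n.+1) ((1 - x i) `^ (b - 1))) * x 0%N `^ (a - 1)).
  by rewrite ler_wpM2r ?powR_ge0// hc.
by ring.
Qed.

Lemma measurable_powR_fun d (T : measurableType d) (f : T -> R) (p : R) :
  measurable_fun setT f -> measurable_fun setT (fun x => f x `^ p).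
Proof. exact: measurableT_comp (@measurable_powR R p). Qed.

Lemma measurable_jacobi_weight (n : nat) (a b g : R) :
  measurable_fun setT (jacobi_weight n a b g : seqT R -> R).
Proof.
apply: measurable_funM; first apply: measurable_funM.
- apply: measurable_prod => i _; rewrite /= (_ : (fun x => _) = (fun x : seqT R =>
      \prod_(j <- [seq j : 'I_n <- index_enum 'I_n | (i < j)%N]) `|x i - x j| `^ (2 * g))); last first.
    by apply/funext => x; rewrite big_filter.
  apply: measurable_prod => j _; apply: measurable_powR_fun.
  by apply: measurableT_comp => //; apply: measurable_funB; exact: measurable_coord.
- by apply: measurable_prod => i _; apply: measurable_powR_fun; exact: measurable_coord.
- apply: measurable_prod => i _; apply: measurable_powR_fun.
  by apply: measurable_funB => //; exact: measurable_coord.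
Qed.

Lemma jacobi_weight_ge0 (n : nat) (a b g : R) x : 0 <= jacobi_weight n a b g x.
Proof.
by rewrite !mulr_ge0 ?prodr_ge0// => i _; rewrite ?powR_ge0// prodr_ge0// => j _; exact: powR_ge0.
Qed.

(** On the box the integrand is at least a constant times x_0^(alpha - 3). If alpha <= 2 this is at
    least a constant times 1/x_0, because x_0 <= 1, and the integral diverges at 0. *)
Lemma jacobi_gt2 (n : nat) (a b g : R) :
  (cube_int n.+1 (fun x => (x 0%N ^- 2 * jacobi_weight n.+1 a b g x)%:E) < +oo)%E -> 2 < a.
Proof.
apply: contraPT; rewrite -leNgt => a2; apply/negP; rewrite -leNgt leye_eq.
have [c c0 wc] := jacobi_weight_box n a b g.
pose d := dl n.+1; have d0 : 0 < d by exact: dl_gt0.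
have dE := dlE n.+1; rewrite -/d -natr1 mulrDl mul1r in dE.
have nd0 : 0 <= n%:R * d by rewrite mulr_ge0// ltW.
set F : seqT R -> \bar R := fun x => _.
have mF : measurable_fun setT F.
  apply/measurable_EFinP; apply: measurable_funM; last exact: measurable_jacobi_weight.
  by apply: measurable_funV; apply: measurable_funX; exact: measurable_coord.
have F0 x : (0 <= F x)%E.
  by rewrite lee_fin mulr_ge0 ?jacobi_weight_ge0// invr_ge0 sqr_ge0.
(* The outer variable t is x_0; the other n variables run over their sides of the box, whose volume
   is d^n. *)
have low t : 0 <= t <= d -> ((c * d ^+ n)%:E * (t^-1)%:E <= cube_int n (fun y => F (scons t y)))%E.
  move=> /andP[t0 td]; rewrite -EFinM mulrAC.
  apply: (@cube_int_box_ge n (fun i => 2 * i.+1%:R * d)) => //.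
  - exact: measurableT_comp mF (measurable_scons2 t).
  - by rewrite mulr_ge0 ?invr_ge0// ltW.
  - move=> i lin; have : i.+1%:R * d <= n%:R * d by rewrite ler_pM2r// ler_nat.
    have : 0 <= i.+1%:R * d by rewrite mulr_ge0// ltW.
    by move: (i.+1%:R * d) (mulrA 2 i.+1%:R d) => u <-; lra.
  - move=> y yb; rewrite lee_fin /=.
    have bx : box n.+1 (scons t y).
      move=> [_|i lin] /=; first by rewrite mulr0 mul0r t0 add0r mul1r.
      have [h1 h2] := andP (yb _ lin).
      by apply/andP; split=> //; rewrite mulrDl mul1r.
    (* At t = 0 the inverse is 0 by convention and the lower bound is trivial. *)
    move: t0; rewrite le_eqVlt => /predU1P[<-|t0].
      by rewrite invr0 mulr0 mulr_ge0 ?jacobi_weight_ge0// invr_ge0 sqr_ge0.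
    have t1 : t <= 1 by apply: le_trans td _; lra.
    apply: le_trans (ler_wpM2l _ (wc _ bx)); last by rewrite invr_ge0 sqr_ge0.
    rewrite /= mulrCA ler_pM2l// ler_pdivlMl ?exprn_gt0// expr2 -mulrA divff ?gt_eqF// mulr1.
    rewrite -[leLHS]powRr1 ?(ltW t0)//.
    by apply: ger_powR; [rewrite t0|lra].
have minv D : measurable_fun D (fun x : R => (x^-1)%:E).
  by apply/measurable_EFinP/measurable_funTS; exact: measurable_inv.
have sub : `[0, d] `<=` `[0, 1] by apply: subset_itvl; rewrite bnd_simp; lra.
have mG : measurable_fun setT (fun t => cube_int n (fun y => F (scons t y))).
  exact: measurable_cube_int_scons.
rewrite -leye_eq.
have S : (\int[mu]_(t in `[0%R, d]) cube_int n (fun y => F (scons t y)) <=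
    \int[mu]_(t in `[0%R, 1%R]) cube_int n (fun y => F (scons t y)))%E.
  apply: ge0_subset_integral => //=; first exact: measurable_funTS.
  by move=> t _; exact: cube_int_ge0.
refine (le_trans _ S).
have inv0 t : `[0, d]%classic t -> (0 <= (t^-1)%:E)%E.
  by rewrite /= in_itv/= => /andP[t0 _]; rewrite lee_fin invr_ge0.
have -> : (+oo = \int[mu]_(t in `[0%R, d]) ((c * d ^+ n)%:E * (t^-1)%:E))%E.
  rewrite ge0_integralZl//; last by rewrite lee_fin mulr_ge0 ?exprn_ge0// ltW.
    by rewrite integral_inv_pinfty// gt0_muley// lte_fin mulr_gt0// exprn_gt0.
  exact: minv.
apply: ge0_le_integral => //=.
- by move=> t td; rewrite mule_ge0 ?inv0// lee_fin mulr_ge0 ?exprn_ge0// ltW.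
- by apply: emeasurable_funM => //; exact: minv.
- exact: measurable_funTS.
Qed.

(** Needed with phi = 1 for a nonzero denominator, and with phi(t) = |1/t - 1| for the strict
    inequality <1/x_1> > 1. Only the upper half of each side of the box is used, so x_0 also stays
    away from 0; since d <= 1/4, it stays below 1/2. *)
Lemma cube_int_jacobi_gt0 (n : nat) (a b g : R) (phi : R -> R) :
  measurable_fun setT phi -> (forall t, 0 <= phi t) ->
  (forall t, 0 < t -> t <= 2^-1 -> 1 <= phi t) ->
  (0 < cube_int n.+1 (fun x => (phi (x 0%N) * jacobi_weight n.+1 a b g x)%:E))%E.
Proof.
move=> mphi phi0 phi1.
have [c c0 wc] := jacobi_weight_box n a b g.
pose d := dl n.+1; have d0 : 0 < d by exact: dl_gt0.
have dE := dlE n.+1; rewrite -/d -natr1 mulrDl mul1r in dE.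
have nd0 : 0 <= n%:R * d by rewrite mulr_ge0// ltW.
set F : seqT R -> \bar R := fun x => _.
have mF : measurable_fun setT F.
  apply/measurable_EFinP; apply: measurable_funM; last exact: measurable_jacobi_weight.
  exact: measurableT_comp mphi (measurable_coord 0).
have F0 x : (0 <= F x)%E by rewrite lee_fin mulr_ge0 ?jacobi_weight_ge0.
have [e e0 he] : ge_pos [set x : nat -> R | d / 2 <= x 0%N <= d] (fun x => x 0%N `^ (a - 1)).
  apply: (@ge_pos_powR _ _ _ (d / 2)); first exact: divr_gt0.
  by move=> x /andP[h1 h2]; lra.
apply: lt_le_trans (@cube_int_box_ge n.+1 (fun i => 2 * i%:R * d + d / 2) (d / 2) (c * e) F mF F0 _ _ _ _).
- by rewrite lte_fin mulr_gt0 ?exprn_gt0 ?divr_gt0// mulr_gt0.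
- by rewrite mulr_ge0// ltW.
- exact: divr_gt0.
- move=> i lin; have : i%:R * d <= n%:R * d by rewrite ler_pM2r// ler_nat.
  have : 0 <= i%:R * d by rewrite mulr_ge0// ltW.
  by move: (i%:R * d) (mulrA 2 i%:R d) => u <-; lra.
- move=> x xb; rewrite lee_fin.
  have bx : box n.+1 x.
    move=> i lin; have [h1 h2] := andP (xb i lin).
    apply/andP; split; first by apply: le_trans h1; rewrite lerDl divr_ge0// ltW.
    by apply: le_trans h2 _; rewrite -addrA -splitr [leRHS]mulrDl mul1r.
  have := xb 0%N isT; rewrite mulr0 mul0r add0r -splitr => x0.
  have [h1 h2] := andP x0.
  rewrite -[leLHS]mul1r; apply: ler_pM => //; first by rewrite mulr_ge0// ltW.
    by apply: phi1; lra.
  by apply: le_trans (wc _ bx); rewrite ler_pM2l//; exact: he.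
Qed.

End lower_bounds.

(** * First-order expansion of the substituted weight *)

Section factors.
Context {R : realType}.

(** Follows from |e^t - 1| <= |t| e^|t| at t = p ln(1 + z), where 0 <= ln(1 + z) <= z. The range z
    <= 2 is the bound on step times pole at admissible points. *)
Lemma powR_sub1_le (p z : R) : 0 <= z -> z <= 2 ->
  `|(1 + z) `^ p - 1| <= `|p| * expR (2 * `|p|) * z.
Proof.
move=> z0 z2; have z1 : 0 < 1 + z by rewrite ltr_pwDl.
rewrite /powR gt_eqF//; set t := p * ln (1 + z).
have lnz : 0 <= ln (1 + z) <= z by rewrite ln_ge0 ?lerDl// le_ln1Dx// (lt_le_trans _ z0)// ltrN10.
have t1 : `|t| <= `|p| * z.
  by rewrite normrM ler_wpM2l// ger0_norm; case/andP: lnz.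
have t2 : `|t| <= 2 * `|p| by apply: le_trans t1 _; rewrite mulrC ler_wpM2r.
have : `|expR t - 1| <= `|t| * expR `|t|.
  have h1 : 1 + t <= expR t := expR_ge1Dx t.
  have h2 : 1 + - t <= expR (- t) := expR_ge1Dx (- t).
  have e0 := expR_gt0 t.
  have [tp|tn] := leP 0 t.
    rewrite ger0_norm; last by rewrite subr_ge0 -expR0 ler_expR.
    rewrite (ger0_norm tp).
    have : (1 + - t) * expR t <= expR (- t) * expR t by rewrite ler_wpM2r// ltW.
    by rewrite -expRD addNr expR0 mulrDl mul1r mulNr lerBlDr => h; rewrite lerBlDr addrC.
  rewrite ler0_norm; last by rewrite subr_le0 -expR0 ler_expR ltW.
  rewrite (ltr0_norm tn).
  apply: (@le_trans _ _ (- t)); first by lra.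
  by rewrite ler_peMr ?oppr_ge0 ?ltW// expR_gt1 oppr_gt0.
move/le_trans; apply; rewrite mulrAC.
by apply: ler_pM; rewrite ?expR_ge0 ?ler_expR.
Qed.

Lemma powR_le_expR (p z : R) : 0 <= z -> z <= 2 -> (1 + z) `^ p <= expR (2 * `|p|).
Proof.
move=> z0 z2; have z1 : 0 < 1 + z by rewrite ltr_pwDl.
rewrite /powR gt_eqF// ler_expR.
have lnz : 0 <= ln (1 + z) <= z by rewrite ln_ge0 ?lerDl// le_ln1Dx// (lt_le_trans _ z0)// ltrN10.
apply: le_trans (ler_norm _) _; rewrite normrM mulrC ler_wpM2r// ger0_norm; case/andP: lnz => //.
by move=> _ /le_trans; apply.
Qed.

Lemma subr_expr_le (N : nat) (z : R) : 0 <= z -> z <= 1 -> 1 - z ^+ N <= N%:R * (1 - z).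
Proof.
move=> z0 z1; elim: N => [|N IH]; first by rewrite expr0 subrr mul0r.
have zN : z ^+ N <= 1 by exact: exprn_ile1.
have : z ^+ N * (1 - z) <= 1 - z by rewrite ler_piMl ?subr_ge0.
rewrite -natr1 exprSr; move: IH; nra.
Qed.

(** For an integer N >= p, z^N <= z^p <= 1 on [0,1], and 1 - z^N <= N (1 - z). Positivity of p
    matters because z may be arbitrarily close to 0. *)
Lemma powR_sub1_le_neg (p : R) : 0 < p -> exists2 C, 0 <= C &
  forall z, 0 <= z -> z <= 1 -> `|z `^ p - 1| <= C * (1 - z).
Proof.
move=> p0; pose N := (Num.truncn p).+1; exists N%:R => // z z0 z1.
have pN : p <= N%:R by apply/ltW; exact: truncnS_gt.
have zp1 : z `^ p <= 1.
  by rewrite -[leRHS](congr1 (@^~ p) (powR1 R)); apply: ge0_ler_powR; rewrite ?nnegrE ?ler01 ?(ltW p0).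
rewrite ler0_norm ?subr_le0// opprB.
apply: le_trans (subr_expr_le N z0 z1).
rewrite lerD2l lerN2.
move: z0; rewrite le_eqVlt => /predU1P[<-|z0]; first by rewrite expr0n /= powR_ge0.
by rewrite -powR_mulrn ?(ltW z0)//; apply: ger_powR => //; rewrite z0.
Qed.

Lemma powR_diffquo_cvg (p u : R) (s : nat -> R) : (forall m, 0 < s m) ->
  s @ \oo --> 0 ->
  (((1 + s m * u) `^ p - 1) / s m @[m --> \oo]) --> p * u.
Proof.
move=> s0 scvg.
have D : is_derive (0 : R) 1 (fun t : R => (1 + t * u) `^ p) (p * u).
  have D1 : is_derive (0 : R) 1 (fun t : R => 1 + t * u) u.
    apply: is_derive_eq. by rewrite /GRing.scale/= add0r mul0r mulr1 add0r mul1r.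
  have D2 : is_derive (1 + 0 * u) 1 (@powR R ^~ p) (p * (1 + 0 * u) `^ (p - 1)).
    by apply: is_derive1_powR; rewrite mul0r addr0.
  have := @is_derive1_comp _ (@powR R ^~ p) (fun t => 1 + t * u) 0 _ _ D2 D1.
  by rewrite mul0r addr0 (congr1 (@^~ (p - 1)) (powR1 R)) mulr1.
have [D1 D2] := D.
have : h^-1 *: ((1 + (h *: 1 + 0) * u) `^ p - (1 + 0 * u) `^ p) @[h --> 0^'] --> p * u.
  by rewrite -D2; exact: D1.
have sd : s @ \oo --> (0 : R)^'.
  move=> A nA; have h : nbhs (s @ \oo) [set y | y != 0 -> A y] by exact: scvg.
  suff : \forall m \near \oo, A (s m) by [].
  by apply: (@filterS _ \oo _ (s @^-1` [set y | y != 0 -> A y])) => // m; apply; exact: lt0r_neq0 (s0 m).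
move=> /(cvg_comp _ _ sd).
rewrite mul0r addr0 (congr1 (@^~ p) (powR1 R)); apply: cvg_trans.
by apply: near_eq_cvg; near=> m; rewrite /GRing.scale/= mulr1 addr0 mulrC.
Unshelve. all: by end_near.
Qed.

End factors.

(** The face at 0 is removed because inverses take a default value there; the face at 1 stays, since
    1 is fixed by the shift. *)
Definition pcube {R : realType} (n : nat) : set (nat -> R) :=
  [set y | forall i, (i < n)%N -> 0 < y i <= 1].

Section first_order.
Context {R : realType}.
Variables (n : nat) (c d : R).
Hypotheses (c0 : 0 <= c) (d0 : 0 <= d).

(** (1 - t) [pole t] is the relative speed at which the shift lowers t, and on ]0,1] a single pole
    dominates each term c + d/t, c + d/t^2 and c + d/(t t'). It is 1/t for (c, d) = (1, 0) and 1/t^2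
    for (0, 1). *)
Definition pole (t : R) : R := (c + d / t) / t.
Definition poles (y : nat -> R) : R := \sum_(i < n) pole (y i).
(** 2c + 4d bounds the pole on [1/2, 1], so with this normalisation step times pole is at most 1
    there. *)
Definition step (m : nat) : R := (1 + 2 * c + 4 * d)^-1 / m.+1%:R.
Definition admissible (m : nat) (y : nat -> R) :=
  [forall i : 'I_n, 0 <= jshift c d (step m) (y i)].

Lemma step_gt0 m : 0 < step m.
Proof. by rewrite /step divr_gt0 ?invr_gt0//; move: c0 d0; lra. Qed.

Lemma step_cvg0 : step @ \oo --> 0.
Proof.
rewrite -[X in _ --> X](mulr0 (1 + 2 * c + 4 * d)^-1).
apply: cvgM; first exact: cvg_cst.
exact: cvg_harmonic.
Qed.

Lemma pole_ge0 t : 0 < t -> 0 <= pole t.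
Proof. by move=> t0; rewrite divr_ge0 ?(ltW t0)// addr_ge0// divr_ge0// ltW. Qed.

Lemma pole_le_poles y (i : 'I_n) : pcube n y -> pole (y i) <= poles y.
Proof.
move=> yD; rewrite /poles (bigD1 i)//= lerDl sumr_ge0// => j _.
by apply: pole_ge0; case/andP: (yD j (ltn_ord j)).
Qed.

Lemma poles_ge0 y : pcube n y -> 0 <= poles y.
Proof.
by move=> yD; apply: sumr_ge0 => i _; apply: pole_ge0; case/andP: (yD _ (ltn_ord i)).
Qed.

Lemma shift_pole s t : 0 < t -> jshift c d s t = t * (1 - s * ((1 - t) * pole t)).
Proof. by move=> t0; rewrite /jshift /pole; field; rewrite gt_eqF. Qed.

(** Admissibility says s (1 - t) pole <= 1. For t <= 1/2 the factor 1 - t is at least 1/2, whence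
    the bound 2; for t > 1/2 the normalisation of [step] gives 1. *)
Lemma step_pole_le2 m y (i : 'I_n) : pcube n y -> admissible m y ->
  step m * pole (y i) <= 2.
Proof.
move=> yD /forallP/(_ i); have /andP[t0 t1] := yD i (ltn_ord i).
rewrite shift_pole// pmulr_rge0// subr_ge0 => h.
have p0 := pole_ge0 t0; have s0 := step_gt0 m.
have [th|th] := leP (y i) 2^-1.
  have : step m * pole (y i) * 2^-1 <= step m * pole (y i) * (1 - y i).
    by apply: ler_wpM2l; [rewrite mulr_ge0// ltW|lra].
  by move: h; rewrite mulrA mulrAC; lra.
have pl : pole (y i) <= 2 * c + 4 * d.
  have i2 : (y i)^-1 <= 2 by rewrite -[leRHS]invrK lef_pV2 ?posrE// ltW.
  have i0 : 0 <= (y i)^-1 by rewrite invr_ge0 ltW.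
  rewrite /pole mulrDl -mulrA.
  have h1 : c * (y i)^-1 <= c * 2 by exact: ler_wpM2l.
  have h2 : (y i)^-1 * (y i)^-1 <= 2 * 2 by exact: ler_pM.
  have h3 : d * ((y i)^-1 * (y i)^-1) <= d * (2 * 2) by exact: ler_wpM2l.
  by lra.
have D0 : 0 < 1 + 2 * c + 4 * d by lra.
apply: (@le_trans _ _ 1); last by lra.
rewrite /step mulrAC ler_pdivrMr// mul1r mulrC ler_pdivrMr//.
by apply: (@le_trans _ _ (1 * (1 + 2 * c + 4 * d))); [lra|rewrite ler_wpM2r ?(ltW D0)// ler1n].
Qed.

(** Some coordinate has s (1 - t) pole > 1. Consequently the error -1 made by cutting the factor to
    0 at such a point is itself dominated by s times the poles, and each fixed point is eventually
    admissible. *)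
Lemma not_admissible_gt1 m y : pcube n y -> ~~ admissible m y -> 1 <= step m * poles y.
Proof.
move=> yD; rewrite negb_forall => /existsP[i].
have /andP[t0 t1] := yD i (ltn_ord i); have p0 := pole_ge0 t0; have s0 := step_gt0 m.
rewrite shift_pole// -ltNge pmulr_rlt0// subr_lt0 => /ltW h.
apply: le_trans h _; rewrite ler_pM2l//.
by apply: le_trans (pole_le_poles i yD); rewrite ler_piMl//; lra.
Qed.

(* [first_order K k] says that K_m = 1 + s_m k + o(s_m) along the steps s_m, with
   K_m - 1 dominated by s_m times the integrable poles. *)
Definition first_order (K : nat -> (nat -> R) -> R) (k : (nat -> R) -> R) :=
  (exists M C, [/\ 0 <= M, 0 <= C & forall m y, pcube n y -> admissible m y ->
     `|K m y| <= M /\ `|K m y - 1| <= C * (step m * poles y)]) /\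
  (forall y, pcube n y -> (K m y - 1) / step m @[m --> \oo] --> k y).

Lemma first_order1 : first_order (fun _ _ => 1) (fun _ => 0).
Proof.
split.
  exists 1, 0; split=> // m y _ _; rewrite normr1 subrr normr0 mul0r; split => //.
by move=> y _; under eq_fun do rewrite subrr mul0r; exact: cvg_cst.
Qed.

(** Rests on K1 K2 - 1 = K1 (K2 - 1) + (K1 - 1); this is why [first_order] also asks for a uniform
    bound on K. *)
Lemma first_orderM K1 k1 K2 k2 : first_order K1 k1 -> first_order K2 k2 ->
  first_order (fun m y => K1 m y * K2 m y) (fun y => k1 y + k2 y).
Proof.
move=> [[M1 [C1 [M10 C10 b1]]] l1] [[M2 [C2 [M20 C20 b2]]] l2]; split.
  exists (M1 * M2), (M1 * C2 + C1); split; rewrite ?addr_ge0 ?mulr_ge0// => m y yD va.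
  have [B1 B1'] := b1 m y yD va; have [B2 B2'] := b2 m y yD va; split.
    by rewrite normrM ler_pM.
  have -> : K1 m y * K2 m y - 1 = K1 m y * (K2 m y - 1) + (K1 m y - 1) by ring.
  rewrite (le_trans (ler_normD _ _))// mulrDl lerD// normrM -mulrA.
  exact: ler_pM.
move=> y yD.
have K1c : K1 m y @[m --> \oo] --> (1 : R).
  rewrite -[X in _ --> X](_ : 1 + 0 * k1 y = 1); last by rewrite mul0r addr0.
  have : 1 + step m * ((K1 m y - 1) / step m) @[m --> \oo] --> 1 + 0 * k1 y.
    by apply: cvgD; [exact: cvg_cst|apply: cvgM; [exact: step_cvg0|exact: l1]].
  apply: cvg_trans; apply: near_eq_cvg; near=> m.
  by rewrite mulrCA divff ?gt_eqF ?step_gt0// mulr1 addrC subrK.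
have : K1 m y * ((K2 m y - 1) / step m) + (K1 m y - 1) / step m @[m --> \oo] --> 1 * k2 y + k1 y.
  by apply: cvgD; [apply: cvgM => //; exact: l2|exact: l1].
rewrite mul1r addrC; apply: cvg_trans; apply: near_eq_cvg; near=> m.
by rewrite mulrA -mulrDl; congr (_ / _); ring.
Unshelve. all: by end_near.
Qed.

Lemma first_order_prod (I : finType) (P : pred I) K k :
  (forall i, P i -> first_order (K i) (k i)) ->
  first_order (fun m y => \prod_(i | P i) K i m y) (fun y => \sum_(i | P i) k i y).
Proof.
move=> h.
rewrite (_ : (fun m y => _) =
  \big[(fun F G m y => F m y * G m y)/(fun _ _ => 1)]_(i | P i) K i); last first.
  apply/funext => m; apply/funext => y.
  by rewrite (big_morph (fun G : nat -> (nat -> R) -> R => G m y) (id1 := 1) (op1 := *%R)).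
rewrite (_ : (fun y => \sum_(i | P i) k i y) = \big[(fun F G y => F y + G y)/(fun _ => 0)]_(i | P i) k i); last first.
  apply/funext => y.
  by rewrite (big_morph (fun G : (nat -> R) -> R => G y) (id1 := 0) (op1 := +%R)).
apply: (big_ind2 first_order) => //; first exact: first_order1.
by move=> K1 k1 K2 k2; exact: first_orderM.
Qed.

Lemma first_order_powR (p : R) (u : (nat -> R) -> R) :
  (forall y, pcube n y -> exists2 i : 'I_n, 0 <= u y & u y <= pole (y i)) ->
  first_order (fun m y => (1 + step m * u y) `^ p) (fun y => p * u y).
Proof.
move=> hu; split.
  exists (expR (2 * `|p|)), (`|p| * expR (2 * `|p|)); split; rewrite ?mulr_ge0 ?expR_ge0//.
  move=> m y yD va; have [i u0 ui] := hu y yD; have s0 := step_gt0 m.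
  have z0 : 0 <= step m * u y by rewrite mulr_ge0// ltW.
  have zi : step m * u y <= step m * pole (y i) by rewrite ler_pM2l.
  have z2 : step m * u y <= 2 by apply: le_trans (step_pole_le2 i yD va).
  split; first by rewrite ger0_norm ?powR_ge0// powR_le_expR.
  apply: le_trans (powR_sub1_le p z0 z2) _; rewrite ler_wpM2l ?mulr_ge0 ?expR_ge0//.
  by apply: le_trans zi _; rewrite ler_pM2l// pole_le_poles.
by move=> y yD; apply: powR_diffquo_cvg; [exact: step_gt0|exact: step_cvg0].
Qed.

(** The one factor that decreases: on admissible points its base lies in [0,1] and can reach 0,
    hence the condition p > 0. *)
Lemma first_order_powR_shift (p : R) (i : 'I_n) : 0 < p ->
  first_order (fun m y => (1 + step m * - ((1 - y i) * pole (y i))) `^ p)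
    (fun y => p * - ((1 - y i) * pole (y i))).
Proof.
move=> p0; split; last first.
  by move=> y yD; apply: powR_diffquo_cvg; [exact: step_gt0|exact: step_cvg0].
have [C C0 hC] := powR_sub1_le_neg p0.
exists 1, C; split=> // m y yD va.
have /andP[t0 t1] := yD i (ltn_ord i); have pp := pole_ge0 t0; have s0 := step_gt0 m.
move: (va) => /forallP/(_ i); rewrite shift_pole// pmulr_rge0// mulrN => z0.
have le1 : (1 - y i) * pole (y i) <= pole (y i) by rewrite ler_piMl//; lra.
have z1 : 1 - step m * ((1 - y i) * pole (y i)) <= 1.
  by rewrite gerBl mulr_ge0 ?(ltW s0)// mulr_ge0// subr_ge0.
split.
  rewrite ger0_norm ?powR_ge0// -[leRHS](congr1 (@^~ p) (powR1 R)).
  by apply: ge0_ler_powR; rewrite ?nnegrE ?ler01 ?(ltW p0).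
apply: le_trans (hC _ z0 z1) _; apply: ler_wpM2l => //.
rewrite opprB addrC subrK ler_pM2l//.
by apply: le_trans le1 _; exact: pole_le_poles.
Qed.

End first_order.

(** * The symmetric form of the weight *)

Section cube_measure.
Context {R : realType}.
Notation mu := (@lebesgue_measure R).

(** The endpoint 0 is negligible in each one-dimensional integral, so identities involving inverses
    need only hold where all coordinates are positive. *)
Lemma eq_cube_int_pcube (k : nat) (F G : seqT R -> \bar R) :
  measurable_fun setT F -> measurable_fun setT G ->
  (forall x, 0 <= F x)%E -> (forall x, 0 <= G x)%E ->
  (forall x, pcube k x -> F x = G x) -> cube_int k F = cube_int k G.
Proof.
elim: k F G => [|k IH] F G mF mG F0 G0 FG /=; first by apply: FG.
rewrite -!integral_itv_obnd_cbnd; last 2 first.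
- by apply: measurable_funTS; exact: measurable_cube_int_scons.
- by apply: measurable_funTS; exact: measurable_cube_int_scons.
apply: eq_integral => t /[!inE]/=; rewrite in_itv/= => t01.
apply: IH => //.
- exact: measurableT_comp mF (measurable_scons2 t).
- exact: measurableT_comp mG (measurable_scons2 t).
- by move=> x xD; apply: FG => -[//|i]; exact: xD.
Qed.

Lemma measurable_pcube (k : nat) : measurable (pcube k : set (seqT R)).
Proof.
rewrite (_ : pcube k = \bigcap_(i in `I_k) ((fun x : seqT R => x i) @^-1` `]0, 1]%classic)).
  apply: bigcap_measurableType => // i _; rewrite -[X in measurable X]setTI.
  exact: measurable_coord.
by apply/seteqP; split => x xD i /xD /=; rewrite in_itv.
Qed.

Lemma cube_int_pcube (k : nat) : exists nu : probability (seqT R) R,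
  forall F : seqT R -> \bar R, measurable_fun setT F -> (forall x, 0 <= F x)%E ->
    cube_int k F = (\int[nu]_(x in pcube k) F x)%E.
Proof.
have [nu nuE] := @cube_int_prob R k; exists nu => F mF F0.
rewrite integral_mkcond -nuE; last 2 first.
- by apply/(measurable_restrictT _ (measurable_pcube k)); exact: measurable_funTS.
- by move=> x; rewrite erestrict_ge0.
apply: eq_cube_int_pcube => //.
- by apply/(measurable_restrictT _ (measurable_pcube k)); exact: measurable_funTS.
- by move=> x; rewrite erestrict_ge0.
- by move=> x xD; rewrite patchE mem_set.
Qed.

End cube_measure.

Section sym_weight.
Context {R : realType}.

(** Products over ordered pairs with exponent g replace unordered pairs with exponent 2g, which
    makes invariance under permutations a reindexing. Separate exponents e_i allow the weight to be
    divided by a single x_m. *)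
Definition sym_weight (n : nat) (e : nat -> R) (f g : R) (x : nat -> R) : R :=
  (\prod_(i < n) \prod_(j < n | j != i) `|x i - x j| `^ g)
  * (\prod_(i < n) x i `^ e i) * (\prod_(i < n) (1 - x i) `^ f).

Lemma sym_weight_ge0 n e f g x : 0 <= sym_weight n e f g x.
Proof.
by rewrite !mulr_ge0 ?prodr_ge0// => i _; rewrite ?powR_ge0// prodr_ge0// => j _; exact: powR_ge0.
Qed.

Lemma measurable_sym_weight n e f g :
  measurable_fun setT (sym_weight n e f g : seqT R -> R).
Proof.
apply: measurable_funM; first apply: measurable_funM.
- apply: measurable_prod => i _; rewrite /= (_ : (fun x => _) = (fun x : seqT R =>
      \prod_(j <- [seq j : 'I_n <- index_enum 'I_n | j != i]) `|x i - x j| `^ g)); last first.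
    by apply/funext => x; rewrite big_filter.
  apply: measurable_prod => j _; apply: measurable_powR_fun.
  by apply: measurableT_comp => //; apply: measurable_funB; exact: measurable_coord.
- by apply: measurable_prod => i _; apply: measurable_powR_fun; exact: measurable_coord.
- apply: measurable_prod => i _; apply: measurable_powR_fun.
  by apply: measurable_funB => //; exact: measurable_coord.
Qed.

Lemma jacobi_weightE n a b g x :
  jacobi_weight n a b g x = sym_weight n (fun=> a - 1) (b - 1) g x.
Proof.
rewrite /jacobi_weight /sym_weight; congr (_ * _ * _).
pose h (i j : 'I_n) := `|x i - x j| `^ g.
(* Adding exponents is delicate at base 0, where the power is 1 for exponent 0 and 0 otherwise;
   equal coordinates are treated apart. *)
have h2 (i j : 'I_n) : `|x i - x j| `^ (2 * g) = h i j * h i j.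
  rewrite /h mulr_natl mulr2n; have [z|z] := eqVneq `|x i - x j| 0.
    rewrite z; have [->|g0] := eqVneq g 0; first by rewrite addr0 !powRr0 mulr1.
    by rewrite !powR0 ?mulr0// -mulr2n mulrn_eq0.
  by rewrite powRD// z implybT.
under eq_bigr do under eq_bigr do rewrite h2.
under eq_bigr do rewrite big_split/=.
rewrite big_split/=.
have -> : \prod_(i < n) \prod_(j < n | j != i) `|x i - x j| `^ g =
    \prod_(i < n) (\prod_(j < n | (i < j)%N) h i j * \prod_(j < n | (j < i)%N) h i j).
  apply: eq_bigr => i _; rewrite (bigID (fun j : 'I_n => (i < j)%N))/=; congr (_ * _).
    by apply: eq_bigl => j; rewrite -val_eqE/= neq_ltn; case: ltngtP.
  by apply: eq_bigl => j; rewrite -val_eqE/= neq_ltn; case: ltngtP.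
rewrite big_split/=; congr (_ * _).
rewrite (exchange_big_dep xpredT)//=; apply: eq_bigr => i _; apply: eq_bigr => j _.
by rewrite /h distrC.
Qed.

Lemma sym_weight_adjswap n (p : R) f g k x : (k.+1 < n)%N ->
  sym_weight n (fun=> p) f g (adjswap k x) = sym_weight n (fun=> p) f g x.
Proof.
move=> kn.
pose s := tperm (Ordinal (ltnW kn)) (Ordinal kn).
have sE (i : 'I_n) : adjswap k x i = x (s i).
  rewrite /adjswap /s permE/= -!val_eqE/=.
  by case: eqP => [//|_]; case: eqP.
rewrite /sym_weight; congr (_ * _ * _).
- rewrite [RHS](reindex_inj (@perm_inj _ s)); apply: eq_bigr => i _.
  rewrite [RHS](reindex_inj (@perm_inj _ s)) /=.
  by apply: eq_big => [j|j _]; rewrite ?(inj_eq perm_inj)// !sE.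
- by rewrite [RHS](reindex_inj (@perm_inj _ s)); apply: eq_bigr => i _; rewrite sE.
- by rewrite [RHS](reindex_inj (@perm_inj _ s)); apply: eq_bigr => i _; rewrite sE.
Qed.

End sym_weight.

(** * The infinitesimal change of variables *)

Section integration_by_parts.
Context {R : realType}.
Variables (n : nat) (nu : probability (seqT R) R).
Hypothesis nuE : forall F : seqT R -> \bar R, measurable_fun setT F ->
  (forall x, 0 <= F x)%E -> cube_int n F = (\int[nu]_(x in pcube n) F x)%E.
Variables (e : nat -> R) (f g c d : R).
Hypotheses (e0 : forall i, (i < n)%N -> 0 < e i).
Hypotheses (c0 : 0 <= c) (d0 : 0 <= d) (cd0 : 0 < c + d).

Let W := sym_weight n e f g.
Let s := step c d.

(** This is div(W v)/W for v_i = -(1 - y_i)(c + d/y_i): the pair interaction, the powers of y_i, the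
    powers of 1 - y_i, and the divergence of v. *)
Definition log_der (y : nat -> R) : R :=
  \sum_(i < n) \sum_(j < n | j != i) g * (c + d / (y i * y j))
  + \sum_(i < n) e i * - ((1 - y i) * pole c d (y i))
  + \sum_(i < n) f * (c + d / y i)
  + \sum_(i < n) (c + d / y i ^+ 2).

(** The Jacobian is written with exponent 1 so that the expansion of powers covers it together with
    the other factors. *)
Let K (m : nat) (y : nat -> R) : R :=
  (\prod_(i < n) \prod_(j < n | j != i) (1 + s m * (c + d / (y i * y j))) `^ g)
  * (\prod_(i < n) (1 + s m * - ((1 - y i) * pole c d (y i))) `^ e i)
  * (\prod_(i < n) (1 + s m * (c + d / y i)) `^ f)
  * (\prod_(i < n) (1 + s m * (c + d / y i ^+ 2)) `^ 1).

Let s0 m : 0 < s m. Proof. exact: step_gt0. Qed.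

Let invV (t : R) : 0 < t -> t <= 1 -> 1 <= t^-1.
Proof. by move=> t0 t1; rewrite -[leLHS]invr1 lef_pV2 ?posrE. Qed.

Let K_first_order : first_order n c d K log_der.
Proof.
rewrite /K /log_der; apply: first_orderM => //; first apply: first_orderM => //; first apply: first_orderM => //.
- apply: first_order_prod => // i _; apply: first_order_prod => // j _.
  apply: first_order_powR => // y yD.
  have /andP[i0 i1] := yD i (ltn_ord i); have /andP[j0 j1] := yD j (ltn_ord j).
  have ii := invV i0 i1; have jj := invV j0 j1.
  have u0 : 0 <= c + d / (y i * y j) by rewrite addr_ge0// divr_ge0// mulr_ge0// ltW.
  (* The term d/(y_i y_j) is dominated by the pole of the smaller of the two coordinates. *)
  have [ij|ij] := leP (y i)^-1 (y j)^-1; [exists j|exists i] => //.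
    rewrite /pole mulrDl invfM mulrA lerD//; first by rewrite ler_peMr.
    rewrite -!mulrA ler_wpM2l// ler_wpM2r// invr_ge0 ltW//.
  rewrite /pole mulrDl invfM mulrA lerD//; first by rewrite ler_peMr.
  by rewrite -!mulrA ler_wpM2l// ler_wpM2l ?invr_ge0// ltW.
- by apply: first_order_prod => // i _; apply: first_order_powR_shift => //; exact: e0.
- apply: first_order_prod => // i _; apply: first_order_powR => // y yD.
  have /andP[i0 i1] := yD i (ltn_ord i); have ii := invV i0 i1.
  have u0 : 0 <= c + d / y i by rewrite addr_ge0// divr_ge0// ltW.
  by exists i => //; rewrite /pole ler_peMr.
- rewrite (_ : (fun y : nat -> R => _) =
      (fun y : nat -> R => \sum_(i < n) 1 * (c + d / y i ^+ 2))); last first.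
    by apply/funext => y; apply: eq_bigr => i _; rewrite mul1r.
  apply: first_order_prod => // i _; apply: first_order_powR => // y yD.
  have /andP[i0 i1] := yD i (ltn_ord i); have ii := invV i0 i1.
  have u0 : 0 <= c + d / y i ^+ 2 by rewrite addr_ge0// divr_ge0// sqr_ge0.
  exists i => //; rewrite /pole mulrDl expr2 invfM mulrA lerD2r ler_peMr//.
Qed.

Let weight_shift m y : pcube n y ->
  W (shiftn c d (s m) n y) * \prod_(i < n) jac c d (s m) (y i) =
  W y * (if admissible n c d m y then K m y else 0).
Proof.
move=> yD.
have y0 (i : 'I_n) : 0 < y i by case/andP: (yD i (ltn_ord i)).
have y1 (i : 'I_n) : 0 <= 1 - y i by case/andP: (yD i (ltn_ord i)); rewrite subr_ge0.
case: ifPn => [/forallP adm|]; last first.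
  rewrite negb_forall => /existsP[i]; rewrite -ltNge => ilt.
  by rewrite (bigD1 i)//= /jac [X in _ && X]leNgt ilt andbF mul0r !mulr0.
have shE (i : 'I_n) : shiftn c d (s m) n y i = jshift c d (s m) (y i).
  by rewrite /shiftn ltn_ord.
rewrite /W /sym_weight /K.
set A := \prod_(i < n) \prod_(j < n | j != i) `|y i - y j| `^ g.
set A' := \prod_(i < n) \prod_(j < n | j != i) (1 + s m * (c + d / (y i * y j))) `^ g.
have -> : \prod_(i < n) \prod_(j < n | j != i)
    `|shiftn c d (s m) n y i - shiftn c d (s m) n y j| `^ g = A * A'.
  rewrite -big_split/=; apply: eq_bigr => i _; rewrite -big_split/=; apply: eq_bigr => j _.
  have p0 : 0 <= 1 + s m * (c + d / (y i * y j)).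
    by rewrite addr_ge0// mulr_ge0 ?(ltW (s0 m))// addr_ge0// divr_ge0// mulr_ge0// ltW.
  by rewrite !shE shiftB ?gt_eqF// normrM (ger0_norm p0) powRM.
have -> : \prod_(i < n) shiftn c d (s m) n y i `^ e i =
   (\prod_(i < n) y i `^ e i) *
   \prod_(i < n) (1 + s m * - ((1 - y i) * pole c d (y i))) `^ e i.
  rewrite -big_split/=; apply: eq_bigr => i _; rewrite shE.
  have := adm i; rewrite shift_pole// pmulr_rge0// mulrN => p0.
  by rewrite powRM// ltW.
have -> : \prod_(i < n) (1 - shiftn c d (s m) n y i) `^ f =
   (\prod_(i < n) (1 - y i) `^ f) * \prod_(i < n) (1 + s m * (c + d / y i)) `^ f.
  rewrite -big_split/=; apply: eq_bigr => i _; rewrite shE.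
  have -> : 1 - jshift c d (s m) (y i) = (1 - y i) * (1 + s m * (c + d / y i)).
    by rewrite /jshift; ring.
  rewrite powRM// addr_ge0// mulr_ge0 ?(ltW (s0 m))// addr_ge0// divr_ge0// ltW//.
have -> : \prod_(i < n) jac c d (s m) (y i) = \prod_(i < n) (1 + s m * (c + d / y i ^+ 2)) `^ 1.
  apply: eq_bigr => i _; rewrite /jac y0 adm /= /dshift powRr1//.
  by rewrite addr_ge0// mulr_ge0 ?(ltW (s0 m))// addr_ge0// divr_ge0// sqr_ge0.
ring.
Qed.

Let mW : measurable_fun setT (W : seqT R -> R).
Proof. exact: measurable_sym_weight. Qed.

Let mD := @measurable_pcube R n.

Let V m (y : seqT R) := W (shiftn c d (s m) n y) * \prod_(i < n) jac c d (s m) (y i).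

Let mV m : measurable_fun setT (V m).
Proof.
apply: measurable_funM; last exact: measurable_prod_jac.
exact: measurableT_comp mW (measurable_shiftn _ _ _ n).
Qed.

Let V0 m y : 0 <= V m y.
Proof. by rewrite mulr_ge0 ?sym_weight_ge0// prodr_ge0// => i _; exact: jac_ge0. Qed.

Hypotheses (iW : nu.-integrable (pcube n) (EFin \o W))
  (iWq : nu.-integrable (pcube n) (EFin \o (fun y => W y * poles n c d y))).

Let integral_V m : (\int[nu]_(y in pcube n) (V m y)%:E = \int[nu]_(y in pcube n) (W y)%:E)%E.
Proof.
rewrite -nuE; last 2 first.
- exact/measurable_EFinP.
- by move=> x; rewrite lee_fin.
rewrite -[RHS]nuE; last 2 first.
- exact/measurable_EFinP.
- by move=> x; rewrite lee_fin sym_weight_ge0.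
rewrite [RHS](cube_substitution c0 d0 cd0 (s0 m))//.
- exact/measurable_EFinP.
- by move=> x; rewrite lee_fin sym_weight_ge0.
Qed.

(** The difference quotients (V_m - W)/s_m have integral 0, because the substitution preserves the
    integral, and they converge to W [log_der] under an integrable bound. Dominated convergence
    yields both the integrability and the value 0. *)
Lemma sym_weight_ibp : measurable_fun setT (log_der : seqT R -> R) ->
  nu.-integrable (pcube n) (EFin \o (fun y => W y * log_der y)) /\
  (\int[nu]_(y in pcube n) (W y * log_der y)%:E = 0)%E.
Proof.
move=> mk.
have [[M [C [M0 C0 KB]]] Kl] := K_first_order.
pose F m (y : seqT R) : R := (V m y - W y) / s m.
have FE m y : pcube n y -> F m y =
    W y * (((if admissible n c d m y then K m y else 0) - 1) / s m).
  by move=> yD; rewrite /F /V weight_shift// -[X in _ - X]mulr1 -mulrBr mulrA.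
(* In the constant 1 + C, the C serves the admissible points and the 1 those where the factor was
   cut to 0. *)
have DC := @dominated_convergence _ (seqT R) R nu (pcube n) mD
  (fun m y => (F m y)%:E) (fun y => (W y * log_der y)%:E)
  (fun y => ((1 + C)%:E * (W y * poles n c d y)%:E)%E).
have [] := DC.
- move=> m; apply/measurable_EFinP/measurable_funTS; apply: measurable_funM => //.
  exact: measurable_funB.
- by apply/measurable_EFinP/measurable_funTS; exact: measurable_funM.
- apply: aeW => y yD; apply/fine_cvgP; split; first by apply: nearW.
  have -> : fine \o (fun m => (F m y)%:E) = (fun m => F m y) by [].
  under eq_fun do rewrite FE//.
  apply: cvgM; first exact: cvg_cst.
  have := Kl y yD; apply: cvg_trans; apply: near_eq_cvg.
  (* Once s_m times the poles drops below 1, the point y is admissible and the cut no longer affects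
     the limit. *)
  have : \forall m \near \oo, s m * poles n c d y < 1.
    have : s m * poles n c d y @[m --> \oo] --> 0 * poles n c d y.
      by apply: cvgM; [exact: step_cvg0|exact: cvg_cst].
    by rewrite mul0r => /cvgr_lt; apply.
  apply: filterS => m sm; case: ifPn => // /(not_admissible_gt1 c0 d0 yD).
  by rewrite leNgt sm.
- exact: integrableZl.
- apply: aeW => y m yD; rewrite FE// -EFinM lee_fin normrM (ger0_norm (sym_weight_ge0 _ _ _ _ _)).
  rewrite mulrCA; apply: ler_wpM2l; first exact: sym_weight_ge0.
  rewrite normrM (ger0_norm (_ : 0 <= (s m)^-1)) ?invr_ge0 ?(ltW (s0 m))//.
  rewrite ler_pdivrMr//.
  have q0 := poles_ge0 c0 d0 yD.
  rewrite -mulrA [poles _ _ _ _ * _]mulrC; case: ifPn => adm.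
    have [_ h] := KB m y yD adm; apply: le_trans h _.
    by rewrite ler_wpM2r ?lerDr// mulr_ge0// ltW.
  rewrite sub0r normrN1; apply: le_trans (not_admissible_gt1 c0 d0 yD adm) _.
  by rewrite ler_peMl ?lerDl// mulr_ge0// ltW.
move=> iWk _ lim; split => //.
suff Z m : (\int[nu]_(y in pcube n) (F m y)%:E = 0)%E.
  move: lim; rewrite /=; under eq_fun do rewrite Z.
  by move=> /(cvg_lim (@ereal_hausdorff R)) <-; rewrite lim_cst//; exact: ereal_hausdorff.
have iV : nu.-integrable (pcube n) (EFin \o V m).
  apply/integrableP; split; first by apply/measurable_EFinP; exact: measurable_funTS.
  under eq_integral do rewrite /= ger0_norm//.
  by rewrite integral_V; have := integrable_fin_num mD iW; rewrite fin_numE => /andP[_]; rewrite ltey.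
rewrite /F; under eq_integral do rewrite mulrC EFinM.
rewrite integralZl//; last first.
  exact: (integrableB mD iV iW).
by rewrite integralB_EFin// integral_V subee ?mule0//; exact: integrable_fin_num.
Qed.

End integration_by_parts.

(** * Linear equations between the moments *)

Section has_integral.
Context d (T : measurableType d) (R : realType) (nu : {measure set T -> \bar R}).
Variables (D : set T) (mD : measurable D).

Definition has_integral (h : T -> R) (v : R) :=
  nu.-integrable D (EFin \o h) /\ (\int[nu]_(x in D) (h x)%:E = v%:E)%E.

Lemma has_integral_fine h : nu.-integrable D (EFin \o h) ->
  has_integral h (\int[nu]_(x in D) h x).
Proof. by move=> ih; split=> //; rewrite /Rintegral fineK//; exact: integrable_fin_num. Qed.

Lemma has_integral_ext h h' v : (forall x, D x -> h x = h' x) ->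
  has_integral h v -> has_integral h' v.
Proof.
move=> hh' [ih eh]; split.
  by apply: eq_integrable ih => // x /[!inE] Dx; rewrite /= hh'.
by rewrite -eh; apply: eq_integral => x /[!inE] Dx; rewrite hh'.
Qed.

Lemma has_integral_unique h h' v v' : has_integral h v -> has_integral h' v' ->
  (forall x, D x -> h x = h' x) -> v = v'.
Proof.
move=> hv hv' hh'; have [_ E'] := has_integral_ext hh' hv.
by have [_] := hv'; rewrite E' => -[].
Qed.

Lemma has_integralD h1 h2 v1 v2 : has_integral h1 v1 -> has_integral h2 v2 ->
  has_integral (fun x => h1 x + h2 x) (v1 + v2).
Proof.
move=> [i1 e1] [i2 e2]; split; first exact: (integrableD mD i1 i2).
under eq_integral do rewrite EFinD.
by rewrite integralD// e1 e2.
Qed.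

Lemma has_integralZl r h v : has_integral h v -> has_integral (fun x => r * h x) (r * v).
Proof.
move=> [ih eh]; split; first exact: (integrableZl mD r ih).
under eq_integral do rewrite EFinM.
by rewrite integralZl// eh.
Qed.

Lemma has_integral0 : has_integral (fun=> 0) 0.
Proof. by split; [exact: integrable0|rewrite integral0]. Qed.

Lemma has_integral_sum (I : finType) (h : I -> T -> R) (v : I -> R) :
  (forall i, has_integral (h i) (v i)) ->
  has_integral (fun x => \sum_i h i x) (\sum_i v i).
Proof.
move=> hv; rewrite (_ : (fun x => _) = \big[(fun F G x => F x + G x)/(fun=> 0)]_i h i); last first.
  by apply/funext => x; rewrite (big_morph (fun G : T -> R => G x) (id1 := 0) (op1 := +%R)).
apply: (big_ind2 has_integral) => //; first exact: has_integral0.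
by move=> h1 v1 h2 v2; exact: has_integralD.
Qed.

End has_integral.

Section moments.
Context {R : realType}.
Variables (n : nat) (nu : probability (seqT R) R).
Hypothesis nuE : forall F : seqT R -> \bar R, measurable_fun setT F ->
  (forall x, 0 <= F x)%E -> cube_int n F = (\int[nu]_(x in pcube n) F x)%E.
Variables (a b g : R).
Hypothesis a2 : 2 < a.

Let w := sym_weight n (fun=> a - 1) (b - 1) g.
Definition psum1 (y : nat -> R) : R := \sum_(i < n) (y i)^-1.
Definition psum2 (y : nat -> R) : R := \sum_(i < n) (y i) ^- 2.
Definition esum2 (y : nat -> R) : R := \sum_(i < n) \sum_(j < n | j != i) (y i * y j)^-1.

Let mD := @measurable_pcube R n.

Lemma psum1_sqr y : psum1 y ^+ 2 = psum2 y + esum2 y.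
Proof.
rewrite expr2 /psum1 mulr_suml /psum2 /esum2 -big_split/=; apply: eq_bigr => i _.
rewrite mulr_sumr (bigD1 i)//=; congr (_ + _); first by rewrite expr2 invfM.
by apply: eq_bigr => j _; rewrite invfM.
Qed.

Lemma measurable_coordV (i : nat) : measurable_fun setT (fun y : seqT R => (y i)^-1).
Proof. by apply: measurable_funV; exact: measurable_coord. Qed.

Lemma measurable_psum1 : measurable_fun setT (psum1 : seqT R -> R).
Proof. by apply: measurable_sum => i; exact: measurable_coordV. Qed.

Let pc1 (y : nat -> R) (i : 'I_n) : pcube n y -> 1 <= (y i)^-1.
Proof.
by move=> yD; have /andP[t0 t1] := yD i (ltn_ord i); rewrite -[leLHS]invr1 lef_pV2 ?posrE.
Qed.

Let pc0 (y : nat -> R) (i : 'I_n) : pcube n y -> y i != 0.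
Proof. by move=> yD; have /andP[t0 t1] := yD i (ltn_ord i); rewrite gt_eqF. Qed.

Lemma psum1_le y : pcube n y -> psum1 y <= psum2 y.
Proof.
move=> yD; apply: ler_sum => i _; rewrite expr2 invfM ler_peMr ?pc1//.
exact: le_trans (pc1 i yD).
Qed.

Lemma psum1_ge0 y : pcube n y -> 0 <= psum1 y.
Proof. by move=> yD; apply: sumr_ge0 => i _; exact: le_trans (pc1 i yD). Qed.

Lemma psum1_sqr_le y : psum1 y ^+ 2 <= 2 * n%:R * psum2 y.
Proof.
rewrite expr2 /psum1 mulr_suml.
have -> : 2 * n%:R * psum2 y = \sum_(i < n) \sum_(j < n) (y i ^- 2 + y j ^- 2).
  under eq_bigr do rewrite big_split/= sumr_const card_ord.
  rewrite big_split/= sumr_const card_ord -sumrMnl.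
  by rewrite -mulrA mulr_natl mulr_natl mulr2n -/(psum2 y) sumrMnl.
apply: ler_sum => i _; rewrite mulr_sumr; apply: ler_sum => j _.
by rewrite -!exprVn; have := sqr_ge0 ((y i)^-1 - (y j)^-1);
  have := sqr_ge0 ((y i)^-1); have := sqr_ge0 ((y j)^-1); nra.
Qed.

Hypotheses (iw : nu.-integrable (pcube n) (EFin \o w))
  (iw2 : nu.-integrable (pcube n) (EFin \o (fun y => w y * psum2 y))).

Let mw : measurable_fun setT (w : seqT R -> R).
Proof. exact: measurable_sym_weight. Qed.

Let w0 y : 0 <= w y. Proof. exact: sym_weight_ge0. Qed.

(** On the cube every 1/y_i is at least 1, so [psum2] controls all lower moments, and mixed products
    by Cauchy-type bounds. Integrability of w [psum2] is thus enough for every moment used. *)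
Let integrable_dom (h : seqT R -> R) r : measurable_fun setT h -> 0 <= r ->
  (forall y, pcube n y -> 0 <= h y <= r * psum2 y) ->
  nu.-integrable (pcube n) (EFin \o (fun y => w y * h y)).
Proof.
move=> mh r0 hh.
apply: (le_integrable mD _ _ (integrableZl mD r iw2)).
  by apply/measurable_EFinP/measurable_funTS; exact: measurable_funM.
move=> y yD; have /andP[h0 h1] := hh y yD; have s0 := le_trans (psum1_ge0 yD) (psum1_le yD).
change ((Num.norm (w y * h y))%:E <= (Num.norm (r * (w y * psum2 y)))%:E)%E; rewrite lee_fin.
rewrite (@ger0_norm _ (w y * h y)) ?(mulr_ge0 (w0 y) h0)//.
rewrite (@ger0_norm _ (r * (w y * psum2 y))) ?(mulr_ge0 r0 (mulr_ge0 (w0 y) s0))//.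
by rewrite mulrCA ler_wpM2l.
Qed.

Lemma integrable_weight_psum1 : nu.-integrable (pcube n) (EFin \o (fun y => w y * psum1 y)).
Proof.
apply: (@integrable_dom psum1 1) => //; first exact: measurable_psum1.
by move=> y yD; rewrite psum1_ge0// mul1r psum1_le.
Qed.

Lemma integrable_weight_psum1_sqr : nu.-integrable (pcube n) (EFin \o (fun y => w y * psum1 y ^+ 2)).
Proof.
apply: (@integrable_dom (fun y => psum1 y ^+ 2) (2 * n%:R)) => //.
- by apply: measurable_funX; exact: measurable_psum1.
- by move=> y yD; rewrite sqr_ge0 psum1_sqr_le.
Qed.

Let iwm (m : 'I_n) : nu.-integrable (pcube n) (EFin \o (fun y => w y * (y m)^-1)).
Proof.
apply: (@integrable_dom (fun y => (y m)^-1) 1) => //; first exact: measurable_coordV.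
move=> y yD; rewrite (le_trans _ (pc1 m yD))// mul1r (le_trans _ (psum1_le yD))//.
rewrite /psum1 (bigD1 m)//= lerDl sumr_ge0// => i _.
exact: le_trans (pc1 i yD).
Qed.

Let iwm1 (m : 'I_n) : nu.-integrable (pcube n) (EFin \o (fun y => w y * ((y m)^-1 * psum1 y))).
Proof.
apply: (@integrable_dom (fun y => (y m)^-1 * psum1 y) (2 * n%:R)) => //.
- by apply: measurable_funM; [exact: measurable_coordV|exact: measurable_psum1].
- move=> y yD; have ym := le_trans ler01 (pc1 m yD).
  rewrite mulr_ge0 ?psum1_ge0//= (le_trans _ (psum1_sqr_le y))// expr2.
  rewrite ler_wpM2r ?psum1_ge0// /psum1 (bigD1 m)//= lerDl sumr_ge0// => i _.
  exact: le_trans (pc1 i yD).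
Qed.

Let I0 := \int[nu]_(y in pcube n) w y.
Let P := \int[nu]_(y in pcube n) (w y * psum1 y).
Let Q := \int[nu]_(y in pcube n) (w y * psum2 y).
Let SS := \int[nu]_(y in pcube n) (w y * psum1 y ^+ 2).
Let A := a + b + (n%:R - 1) * g - 1.

Let hI : has_integral nu (pcube n) w I0. Proof. exact: has_integral_fine. Qed.
Let hP : has_integral nu (pcube n) (fun y => w y * psum1 y) P.
Proof. exact: (has_integral_fine mD integrable_weight_psum1). Qed.
Let hQ : has_integral nu (pcube n) (fun y => w y * psum2 y) Q.
Proof. exact: (has_integral_fine mD iw2). Qed.
Let hS : has_integral nu (pcube n) (fun y => w y * psum1 y ^+ 2) SS.
Proof. exact: (has_integral_fine mD integrable_weight_psum1_sqr). Qed.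

Lemma measurable_log_der e f (c d : R) :
  measurable_fun setT (log_der n e f g c d : seqT R -> R).
Proof.
have mi i := @measurable_coord R i; have mV i := measurable_coordV i.
apply: measurable_funD; first apply: measurable_funD; first apply: measurable_funD.
- apply: measurable_sum => i.
  rewrite (_ : (fun y => _) = (fun y : seqT R => \sum_(j < n)
     (if j != i then g * (c + d / (y i * y j)) else 0))); last first.
    by apply/funext => y; rewrite big_mkcond.
  apply: measurable_sum => j; case: (j != i) => //.
  apply: measurable_funM => //; apply: measurable_funD => //; apply: measurable_funM => //.
  by apply: measurable_funV; exact: measurable_funM.
- apply: measurable_sum => i; apply: measurable_funM => //; apply: measurableT_comp => //.
  apply: measurable_funM; first exact: measurable_funB.
  apply: measurable_funM => //; apply: measurable_funD => //; exact: measurable_funM.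
- apply: measurable_sum => i; apply: measurable_funM => //; apply: measurable_funD => //.
  exact: measurable_funM.
- apply: measurable_sum => i; apply: measurable_funD => //; apply: measurable_funM => //.
  by apply: measurable_funV; exact: measurable_funX.
Qed.

Let card_off (x : R) : \sum_(i < n) \sum_(j < n | j != i) x = n%:R * (n%:R - 1) * x.
Proof.
transitivity (\sum_(i < n) ((n%:R - 1) * x)).
  apply: eq_bigr => i _; have : \sum_(j < n) x = n%:R * x by rewrite sumr_const card_ord mulr_natl.
  by rewrite (bigD1 i)//= => h; rewrite mulrBl mul1r -h addrAC subrr add0r.
by rewrite sumr_const card_ord -mulrA mulr_natl.
Qed.

Let log_der10 y : pcube n y ->
  log_der n (fun=> a - 1) (b - 1) g 1 0 y = n%:R * A - (a - 1) * psum1 y.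
Proof.
move=> yD; rewrite /log_der.
have -> : \sum_(i < n) \sum_(j < n | j != i) g * (1 + 0 / (y i * y j)) = n%:R * (n%:R - 1) * g.
  by rewrite -card_off; apply: eq_bigr => i _; apply: eq_bigr => j _; rewrite mul0r addr0 mulr1.
have -> : \sum_(i < n) (a - 1) * - ((1 - y i) * pole 1 0 (y i)) =
    n%:R * (a - 1) - (a - 1) * psum1 y.
  have -> : n%:R * (a - 1) = \sum_(i < n) (a - 1) by rewrite sumr_const card_ord mulr_natl.
  rewrite /psum1 mulr_sumr -sumrB.
  by apply: eq_bigr => i _; rewrite /pole; field; exact: pc0.
have -> : \sum_(i < n) (b - 1) * (1 + 0 / y i) = n%:R * (b - 1).
  under eq_bigr do rewrite mul0r addr0 mulr1.
  by rewrite sumr_const card_ord mulr_natl.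
have -> : \sum_(i < n) (1 + 0 / y i ^+ 2) = n%:R :> R.
  under eq_bigr do rewrite mul0r addr0.
  by rewrite sumr_const card_ord.
by rewrite /A; ring.
Qed.

Let poles10 y : poles n 1 0 y = psum1 y.
Proof. by apply: eq_bigr => i _; rewrite /pole mul0r addr0 mul1r. Qed.

Let a1 : 0 < a - 1. Proof. by move: a2; lra. Qed.

Lemma first_moment_eq : (a - 1) * P = n%:R * A * I0.
Proof.
have [] := @sym_weight_ibp R n nu nuE (fun=> a - 1) (b - 1) g 1 0 (fun _ _ => a1) ler01 (lexx 0) _ iw _
  (measurable_log_der _ _ _ _).
- by rewrite addr0.
- by apply: eq_integrable integrable_weight_psum1 => // y _; rewrite /= poles10.
move=> h1 h2.
have hZ : has_integral nu (pcube n) (fun y => w y * log_der n (fun=> a - 1) (b - 1) g 1 0 y) 0 by [].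
have hE := has_integralD mD (has_integralZl mD (n%:R * A) hI) (has_integralZl mD (- (a - 1)) hP).
have : 0 = n%:R * A * I0 + - (a - 1) * P.
  by apply: (has_integral_unique mD hZ hE) => y yD; rewrite log_der10//; ring.
by move/eqP; rewrite eq_sym mulNr subr_eq0 => /eqP.
Qed.

(** For d = 1 the pair terms produce 1/(x_i x_j); by [psum1_sqr] their sum is [psum1]^2 - [psum2],
    whose integral against w is SS - Q. *)
Lemma second_moment_eq : (a - 2) * Q = (a + b - 2) * P + g * (SS - Q).
Proof.
have [] := @sym_weight_ibp R n nu nuE (fun=> a - 1) (b - 1) g 0 1 (fun _ _ => a1) (lexx 0) ler01 _ iw _
  (measurable_log_der _ _ _ _).
- by rewrite add0r.
- apply: eq_integrable iw2 => // y _ /=; congr (_ * _)%:E.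
  by apply: eq_bigr => i _; rewrite /pole add0r mul1r expr2 invfM.
move=> h1 h2.
have hZ : has_integral nu (pcube n) (fun y => w y * log_der n (fun=> a - 1) (b - 1) g 0 1 y) 0 by [].
have hE := has_integralD mD (has_integralD mD (has_integralZl mD g hS) (has_integralZl mD (a + b - 2) hP))
  (has_integralZl mD (- (a - 2) - g) hQ).
have : 0 = g * SS + (a + b - 2) * P + (- (a - 2) - g) * Q.
  apply: (has_integral_unique mD hZ hE) => y yD; rewrite /log_der.
  have -> : \sum_(i < n) \sum_(j < n | j != i) g * (0 + 1 / (y i * y j)) = g * esum2 y.
    rewrite /esum2 mulr_sumr; apply: eq_bigr => i _; rewrite mulr_sumr.
    by apply: eq_bigr => j _; rewrite add0r mul1r.
  have -> : \sum_(i < n) (a - 1) * - ((1 - y i) * pole 0 1 (y i)) =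
      (a - 1) * psum1 y - (a - 1) * psum2 y.
    rewrite /psum1 /psum2 !mulr_sumr -sumrB.
    by apply: eq_bigr => i _; rewrite /pole; field; exact: pc0.
  have -> : \sum_(i < n) (b - 1) * (0 + 1 / y i) = (b - 1) * psum1 y.
    by rewrite mulr_sumr; apply: eq_bigr => i _; rewrite add0r mul1r.
  have -> : \sum_(i < n) (0 + 1 / y i ^+ 2) = psum2 y.
    by apply: eq_bigr => i _; rewrite add0r mul1r.
  by rewrite psum1_sqr; ring.
by move=> /esym h; apply/eqP; rewrite -subr_eq0; apply/eqP; rewrite -[RHS]oppr0 -h; ring.
Qed.

(** Exponents of w/x_m: alpha - 2 at index m and alpha - 1 elsewhere, all positive since alpha >
    2. *)
Let e_ (m : 'I_n) (i : nat) := a - 1 - (i == m)%:R.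

Let sym_weight_e m y : pcube n y -> sym_weight n (e_ m) (b - 1) g y = w y * (y m)^-1.
Proof.
move=> yD; have y0 : 0 < y m by case/andP: (yD m (ltn_ord m)).
rewrite /w /sym_weight.
have -> : \prod_(i < n) y i `^ e_ m i = (\prod_(i < n) y i `^ (a - 1)) * (y m)^-1.
  rewrite (bigD1 m)//= [X in _ = X * _](bigD1 m)//= /e_ eqxx.
  rewrite powRD ?(gt_eqF y0) ?implybT// powR_inv1 ?(ltW y0)//.
  rewrite (eq_bigr (fun i : 'I_n => y i `^ (a - 1))); first by ring.
  by move=> i im; rewrite val_eqE (negbTE im) subr0.
by ring.
Qed.

(** The first two equations leave Q and SS tied by one relation only; this gives a second one.
    Dividing the weight by x_m adds 1/x_m - 1 to the logarithmic derivative for (1, 0), and summing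
    over m restores symmetric functions. *)
Lemma mixed_moment_eq : (a - 2) * Q + (a - 1) * (SS - Q) = (n%:R * A - 1) * P.
Proof.
have e0 m i : (i < n)%N -> 0 < e_ m i.
  by move=> _; rewrite /e_; case: (_ == _) => /=; move: a2; lra.
have hm (m : 'I_n) : has_integral nu (pcube n) (fun y =>
    w y * ((n%:R * A - 1) * (y m)^-1 - (a - 1) * ((y m)^-1 * psum1 y) + y m ^- 2)) 0.
  have [] := @sym_weight_ibp R n nu nuE (e_ m) (b - 1) g 1 0 (e0 m) ler01 (lexx 0) _ _ _
    (measurable_log_der _ _ _ _).
  - by rewrite addr0.
  - by apply: eq_integrable (iwm m) => // y /[!inE] yD; rewrite /= sym_weight_e.
  - apply: eq_integrable (iwm1 m) => // y /[!inE] yD.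
    by rewrite /= sym_weight_e// poles10 mulrA.
  move=> h1 h2.
  have hZ : has_integral nu (pcube n)
    (fun y => sym_weight n (e_ m) (b - 1) g y * log_der n (e_ m) (b - 1) g 1 0 y) 0 by [].
  apply: has_integral_ext hZ => // y yD; rewrite sym_weight_e//.
  have -> : log_der n (e_ m) (b - 1) g 1 0 y =
      log_der n (fun=> a - 1) (b - 1) g 1 0 y + ((y m)^-1 - 1).
    rewrite /log_der.
    have -> : \sum_(i < n) e_ m i * - ((1 - y i) * pole 1 0 (y i)) =
        \sum_(i < n) (a - 1) * - ((1 - y i) * pole 1 0 (y i)) + ((y m)^-1 - 1).
      rewrite (bigD1 m)//= [X in _ = X + _](bigD1 m)//= /e_ eqxx /=.
      rewrite (eq_bigr (fun i : 'I_n => (a - 1) * - ((1 - y i) * pole 1 0 (y i)))); last first.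
        by move=> i im; rewrite val_eqE (negbTE im) subr0.
      set X := \sum_(i < n | _) _.
      by rewrite /pole; field; exact: pc0.
    by ring.
  by rewrite log_der10//; field; exact: pc0.
have hsum := has_integral_sum mD hm.
have hE := has_integralD mD (has_integralD mD (has_integralZl mD (n%:R * A - 1) hP)
  (has_integralZl mD (- (a - 1)) hS)) hQ.
have : \sum_(i < n) 0 = (n%:R * A - 1) * P + - (a - 1) * SS + Q.
  apply: (has_integral_unique mD hsum hE) => y yD.
  rewrite -mulr_sumr !big_split/= sumrN -!mulr_sumr -mulr_suml -/(psum1 y) -/(psum2 y).
  by ring.
rewrite big1// => h; apply/eqP; rewrite -subr_eq0; apply/eqP; rewrite -[RHS]oppr0 h; ring.
Qed.

End moments.

(** * Elimination between the three moment equations *)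

Lemma inverse_square_moment (R : realType) (n a b g I0 P q T : R) :
  2 < a -> 0 < I0 -> 1 <= n -> n * I0 < P -> (n = 1 -> T = 0) ->
  (a - 1) * P = n * (a + b + (n - 1) * g - 1) * I0 ->
  (a - 2) * (n * q) = (a + b - 2) * P + g * T ->
  (a - 2) * (n * q) + (a - 1) * T = (n * (a + b + (n - 1) * g - 1) - 1) * P ->
  q / I0 = (a + b + (n - 1) * g - 1) / ((a - 1) * (a - 2)) *
    (a + b - 2 + g * (n - 1) * (a + b + n * g - 1) / (a + g - 1)).
Proof.
move=> a2 I0_gt0 n1 P_gt T0 E1 E2 E3.
have n0 : 0 < n by exact: lt_le_trans n1.
have P0 : 0 < P by apply: lt_trans P_gt; exact: mulr_gt0.
have a1n : a - 1 != 0 by apply/eqP => h; move: a2; lra.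
have a2n : a - 2 != 0 by apply/eqP => h; move: a2; lra.
set A := a + b + (n - 1) * g - 1 in E1 E3 *.
(* Subtracting the second equation from the third removes the second moment; the coefficient of P is
   n A - 1 - (a + b - 2) = (n - 1)(a + b + n g - 1). *)
have ET : (a + g - 1) * T = (n - 1) * (a + b + n * g - 1) * P.
  have h : (a - 1) * T + g * T = (n * A - 1) * P - (a + b - 2) * P.
    by rewrite -E3 E2; ring.
  by transitivity ((a - 1) * T + g * T); [ring|rewrite h /A; ring].
have PE : P = n * A * I0 / (a - 1) by rewrite -E1 mulrAC mulfV// mul1r.
have qE : q = ((a + b - 2) * P + g * T) / (n * (a - 2)).
  by rewrite -E2; field; rewrite (gt_eqF n0) a2n.
(* For n = 1 the number a + g - 1 may vanish, but T = 0 and the last term of the formula carries the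
   factor n - 1, so both sides agree whatever the quotient is. *)
rewrite qE; have [n1E|nn1] := eqVneq n 1.
  rewrite (T0 n1E) PE n1E subrr mulr0 !mul0r !addr0.
  by field; rewrite (gt_eqF I0_gt0) a1n a2n.
have n1_gt0 : 0 < n - 1 by rewrite subr_gt0 lt_neqAle eq_sym nn1.
have ag : a + g - 1 != 0.
  (* If a + g = 1, then [ET] forces a + b + n g - 1 = 0, so A = -g = a - 1 and P = n I0, against the
     strict inequality. *)
  apply/eqP => ag0; move/eqP: ET; rewrite ag0 mul0r eq_sym !mulf_eq0.
  rewrite (gt_eqF n1_gt0) (gt_eqF P0) orbF/= => /eqP B0.
  have AE : A = a - 1 by rewrite /A; move: B0 ag0; lra.
  by move: P_gt; rewrite PE AE mulrAC mulfK// ltxx.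
have -> : T = (n - 1) * (a + b + n * g - 1) * P / (a + g - 1).
  by rewrite -ET mulrAC mulfV// mul1r.
by rewrite PE; field; rewrite (gt_eqF I0_gt0) (gt_eqF n0) a1n a2n ag.
Qed.

(** * Finite cube integrals as moments, and the strict bound on the mean of 1/x *)

Section cube_probability.
Context {R : realType}.
Variables (n : nat) (nu : probability (seqT R) R).
Hypothesis nuE : forall F : seqT R -> \bar R, measurable_fun setT F ->
  (forall x, 0 <= F x)%E -> cube_int n F = (\int[nu]_(x in pcube n) F x)%E.

Let mD := @measurable_pcube R n.

Lemma cube_int_has_integral (h : seqT R -> R) :
  measurable_fun setT h -> (forall x, 0 <= h x) ->
  (cube_int n (fun x => (h x)%:E) < +oo)%E ->
  has_integral nu (pcube n) h (fine (cube_int n (fun x => (h x)%:E))).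
Proof.
move=> mh h0 fh.
have E : cube_int n (fun x => (h x)%:E) = (\int[nu]_(x in pcube n) (h x)%:E)%E.
  by apply: nuE => [|x]; [exact/measurable_EFinP|rewrite lee_fin].
have ih : nu.-integrable (pcube n) (EFin \o h).
  apply/integrableP; split; first by apply/measurable_EFinP; exact: measurable_funTS.
  by under eq_integral do rewrite /= ger0_norm//; rewrite -E.
by split=> //; rewrite E fineK//; exact: integrable_fin_num.
Qed.

(** P - n I0 is the integral of w times the sum of the 1/x_i - 1, all nonnegative on the cube; the
    first of these terms alone already has a positive integral. *)
Lemma mean_psum1_gt (w : seqT R -> R) (I0 P : R) : (0 < n)%N ->
  measurable_fun setT w -> (forall x, 0 <= w x) ->
  (forall phi : R -> R, measurable_fun setT phi -> (forall t, 0 <= phi t) ->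
    (forall t, 0 < t -> t <= 2^-1 -> 1 <= phi t) ->
    (0 < cube_int n (fun x => (phi (x 0%N) * w x)%:E))%E) ->
  has_integral nu (pcube n) w I0 ->
  has_integral nu (pcube n) (fun y => w y * psum1 n y) P ->
  n%:R * I0 < P.
Proof.
move=> n0 mw w0 wpos hw hP.
(* The absolute value only makes phi nonnegative on the whole line; on ]0,1] it equals 1/t - 1,
   which is at least 1 for t <= 1/2. *)
pose phi (t : R) := `|t^-1 - 1|.
have mphi : measurable_fun setT phi.
  apply: measurableT_comp; first exact: normr_measurable.
  by apply: measurable_funB; [exact: measurable_inv|exact: measurable_cst].
have mphiw : measurable_fun setT (fun x : seqT R => phi (x 0%N) * w x).
  by apply: measurable_funM => //; exact: measurableT_comp mphi (measurable_coord 0).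
have phiw0 x : (0 <= (phi (x 0%N) * w x)%:E)%E by rewrite lee_fin mulr_ge0// normr_ge0.
have phi1 t : 0 < t -> t <= 2^-1 -> 1 <= phi t.
  move=> t0 t2.
  have : 2 <= t^-1 by rewrite -[leLHS]invrK lef_pV2 ?posrE// invr_gt0.
  by rewrite /phi => h; rewrite ger0_norm; move: h; lra.
have := wpos phi mphi (fun=> normr_ge0 _) phi1.
rewrite nuE//; last exact/measurable_EFinP.
have [iB hB] := has_integralD mD hP (has_integralZl mD (- n%:R) hw).
move=> h; rewrite -subr_gt0 -mulNr -lte_fin -hB; apply: lt_le_trans h _.
apply: ge0_le_integral.
- exact: mD.
- by move=> y _; exact: phiw0.
- by apply/measurable_EFinP; exact: measurable_funTS.
- exact: measurable_int iB.
- move=> y yD; rewrite lee_fin.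
  have -> : w y * psum1 n y + - n%:R * w y = (psum1 n y - n%:R) * w y by ring.
  rewrite ler_wpM2r//.
  have y1 (i : 'I_n) : 0 <= (y i)^-1 - 1.
    have /andP[t0 t1] := yD i (ltn_ord i).
    by rewrite subr_ge0 -[leLHS]invr1 lef_pV2 ?posrE.
  have -> : psum1 n y - n%:R = \sum_(i < n) ((y i)^-1 - 1).
    by rewrite sumrB sumr_const card_ord.
  rewrite (bigD1 (Ordinal n0))//= /phi ger0_norm ?(y1 (Ordinal n0))// lerDl.
  by apply: sumr_ge0 => i _; exact: y1.
Qed.

End cube_probability.

Lemma esum2_1 (R : realType) (y : nat -> R) : esum2 1 y = 0.
Proof.
rewrite /esum2 big_ord1 big1// => j; rewrite (_ : j = ord0) ?eqxx//.
by apply/val_inj; case: j => -[].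
Qed.

Section jacobi_symmetry.
Context {R : realType}.
Variables (n : nat) (a b g : R).
Let w := sym_weight n (fun=> a - 1) (b - 1) g.

Lemma measurable_inv_sqr_weight (j : nat) :
  measurable_fun setT (fun x : seqT R => x j ^- 2 * w x).
Proof.
apply: measurable_funM; last exact: measurable_sym_weight.
by apply: measurable_funV; apply: measurable_funX; exact: measurable_coord.
Qed.

Lemma inv_sqr_weight_ge0 (j : nat) x : 0 <= x j ^- 2 * w x.
Proof. by rewrite mulr_ge0 ?sym_weight_ge0// invr_ge0 sqr_ge0. Qed.

Lemma cube_int_inv_sqr (i : nat) : (i < n)%N ->
  cube_int n (fun x => (x i ^- 2 * w x)%:E) = cube_int n (fun x => (x 0%N ^- 2 * w x)%:E).
Proof.
apply: (@cube_int_symm R n i (fun j x => (x j ^- 2 * w x)%:E)).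
- by move=> j; apply/measurable_EFinP; exact: measurable_inv_sqr_weight.
- by move=> j x; rewrite lee_fin inv_sqr_weight_ge0.
- move=> j x jn; congr (_ * _)%:E; last by rewrite /w sym_weight_adjswap.
  by rewrite /adjswap eqxx.
Qed.

End jacobi_symmetry.

Theorem theorem2 (R : realType) (n : nat) (a b g : R) :
  (1 <= n)%N ->
  (cube_int n (fun x => (jacobi_weight n a b g x)%:E) < +oo)%E ->
  (cube_int n (fun x => ((x 0%N) ^- 2 * jacobi_weight n a b g x)%:E) < +oo)%E ->
  jacobi_avg n a b g (fun x => (x 0%N) ^- 2) =
    (a + b + (n%:R - 1) * g - 1) / ((a - 1) * (a - 2)) *
    (a + b - 2 + g * (n%:R - 1) * (a + b + n%:R * g - 1) / (a + g - 1)).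
Proof.
move=> n0 fw fq.
have pos (phi : R -> R) : measurable_fun setT phi -> (forall t, 0 <= phi t) ->
    (forall t, 0 < t -> t <= 2^-1 -> 1 <= phi t) ->
    (0 < cube_int n (fun x => (phi (x 0%N) * jacobi_weight n a b g x)%:E))%E.
  by case: n n0 {fw fq} => [//|N] _; exact: cube_int_jacobi_gt0.
have a2 : 2 < a by case: n n0 fq {fw pos} => [//|N] _; exact: jacobi_gt2.
have [nu nuE] := @cube_int_pcube R n.
have mD := @measurable_pcube R n.
rewrite /jacobi_avg.
have jwE : jacobi_weight n a b g = sym_weight n (fun=> a - 1) (b - 1) g.
  by apply/funext => x; exact: jacobi_weightE.
rewrite jwE in fw fq pos *; set w := sym_weight _ _ _ _ in fw fq pos *.
have mw : measurable_fun setT (w : seqT R -> R) := measurable_sym_weight _ _ _ _.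
have w0 (x : nat -> R) : 0 <= w x := sym_weight_ge0 _ _ _ _ _.
have hw := cube_int_has_integral nuE mw w0 fw.
have I0_gt0 : 0 < fine (cube_int n (fun x => (w x)%:E)).
  have := pos (fun=> 1) (measurable_cst _) (fun=> ler01) (fun _ _ _ => lexx 1).
  under [X in cube_int _ X]eq_fun do rewrite mul1r.
  by move=> h; apply: fine_gt0; rewrite h fw.
move: (fine _) hw I0_gt0 => I0 hw I0_gt0.
have hF (i : 'I_n) := cube_int_has_integral nuE (measurable_inv_sqr_weight n a b g i)
  (inv_sqr_weight_ge0 n a b g i).
have {}hF (i : 'I_n) : has_integral nu (pcube n) (fun x => x i ^- 2 * w x)
    (fine (cube_int n (fun x => (x 0%N ^- 2 * w x)%:E))).
  rewrite -(cube_int_inv_sqr a b g (ltn_ord i)); apply: hF.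
  by rewrite cube_int_inv_sqr.
move: (fine _) hF => q hF {fq fw}.
have hQ : has_integral nu (pcube n) (fun y => w y * psum2 n y) (n%:R * q).
  have -> : n%:R * q = \sum_(i < n) q by rewrite sumr_const card_ord mulr_natl.
  apply: (has_integral_ext mD _ (has_integral_sum mD hF)) => y _.
  by rewrite /psum2 mulr_sumr; apply: eq_bigr => i _; rewrite mulrC.
have [iw _] := hw; have [iw2 _] := hQ.
have hP := has_integral_fine mD (integrable_weight_psum1 iw2).
have hS := has_integral_fine mD (integrable_weight_psum1_sqr iw2).
have E1 := first_moment_eq nuE a2 iw iw2.
have E2 := second_moment_eq nuE a2 iw iw2.
have E3 := mixed_moment_eq nuE a2 iw2.
have I0E := has_integral_unique mD (has_integral_fine mD iw) hw (fun _ _ => erefl).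
have QE := has_integral_unique mD (has_integral_fine mD iw2) hQ (fun _ _ => erefl).
rewrite I0E in E1; rewrite QE in E2 E3.
apply: (inverse_square_moment a2 I0_gt0 _ _ _ E1 E2 E3).
- by rewrite ler1n.
- exact: (mean_psum1_gt nuE n0 mw w0 pos hw hP).
(* For a single variable there are no pairs, so [psum1]^2 = [psum2] and the mixed moment SS - Q
   vanishes. *)
- move=> /eqP; rewrite (eqr_nat R n 1) => /eqP n1; apply/eqP; rewrite subr_eq0; apply/eqP.
  apply: (has_integral_unique mD hS hQ) => y _.
  have e0 : esum2 n y = 0 by rewrite n1 esum2_1.
  by rewrite psum1_sqr e0 addr0.
Qed.
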